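(* Let $M$ be an oriented $n$-dimensional manifold equipped with a Riemannian metric $g$. Then there exists on $M$ a unique positive differential $n$-form $\omega$ such that $\mathrm{Heron}_g$ and $\omega^2$ agree on all 2-infinitesimal $n$-simplices, i.e. $\mathrm{Heron}_g(X)=\omega^2(X)$ for every 2-infinitesimal $n$-simplex $X=(x_0,\ldots,x_n)$ in $M$.
   Context: Setting: synthetic differential geometry (SDG). One works in the internal (intuitionistic) language of a category with finite limits (e.g. a topos) with a commutative ring object $R$ (the number line), in which positive integers are invertible, satisfying the general Kock–Lawvere axiom scheme (functions to $R$ on infinitesimal objects such as $D_r(n)$ and products $D_r(n)^k$ are uniquely given by polynomials modulo the defining relations of the object). An $n$-dimensional manifold is locally identified, through coordinate charts, with open subsets of $R^n$. Neighbour relations: for $x,y\in R^n$, $x\sim_r y$ means that $\phi(x-y,\ldots,x-y)=0$ for every $(r+1)$-linear $\phi:(R^n)^{r+1}\to R$; $D_r(n)=\{x\in R^n: x\sim_r 0\}$. On a manifold $M$, $\sim_r$ is defined through charts (independently of the chart); it is reflexive and symmetric, and $M_{(r)}=\{(x,y)\in M\times M: x\sim_r y\}$. An $r$-infinitesimal $k$-simplex in $M$ is a tuple $(x_0,\ldots,x_k)\in M^{k+1}$ with $x_i\sim_r x_j$ for all $i,j$. Forms: a (combinatorial) differential $k$-form $\omega$ on $M$ is an $R$-valued function on the 1-infinitesimal $k$-simplices in $M$ that is alternating with respect to the $(k+1)!$ permutations of the vertices. An extended $k$-form is an $R$-valued function on the 2-infinitesimal $k$-simplices that vanishes on simplices where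 two vertices are equal. For a differential $k$-form $\omega$, the function $\omega^2$ on 2-infinitesimal $k$-simplices is defined by $\omega^2(X)=\overline\omega(X)^2$, where $\overline\omega$ is any extended $k$-form (defined on a coordinate chart containing the simplex) whose restriction to 1-infinitesimal $k$-simplices is $\omega$; such extensions exist in charts and the square does not depend on the choice. For $f:M\to R$ and an $n$-form $\delta$, $(f\cdot\delta)(x_0,\ldots,x_n)=f(x_0)\,\delta(x_0,\ldots,x_n)$. Positivity: $R$ is equipped with a subset $P\subseteq R$ (the positive elements), stable under addition and multiplication, such that elements of $P$ are invertible and have unique positive square roots, and such that for every invertible $x\in R$ either $x\in P$ or $-x\in P$. Metric: a 1-square-density (pseudo-Riemannian metric) is a function $g:M_{(2)}\to R$ with $g(x,x)=0$ and $g(x,y)=g(y,x)$. In a chart identifying part of $M$ with an open subset of $R^n$ it is given by symmetric $n\times n$ matrices $G(x)$ with $g(x,y)=(x-y)^T G(x)(x-y)$ for $x\sim_2 y$. It is Riemannian if in local coordinate charts $G$ is positive definite, meaning: for each $x$, $\det G(x)$ is invertible and $G(x)=H(x)^T H(x)$ for some $n\times n$ matrix $H(x)$. Orientation: an orientation form on the $n$-dimensional manifold $M$ is a differential $n$-form $\delta$ such that every differential $n$-form on $M$ can be written $f\cdot\delta$ for a unique $f:M\to R$. An orientation on $M$ is given by an orientation form; $\delta_1,\delta_2$ define the same orientation if $\delta_2=f\cdot\delta_1$ for some $f:M\to P$. An $n$-form $\omega$ is positive if $\omega=f\cdot\delta$ for some $f:M\to P$, where $\delta$ gives the orientation. Heron: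 for a 2-infinitesimal $k$-simplex $X=(x_0,\ldots,x_k)$, the Cayley–Menger matrix $C(X)$ is the $(k+2)\times(k+2)$ matrix obtained from the $(k+1)\times(k+1)$ matrix $(g(x_i,x_j))_{i,j=0,\ldots,k}$ by bordering it with the row $(0,1,\ldots,1)$ on top and the column $(0,1,\ldots,1)^T$ on the left; and $\mathrm{Heron}_g(X)=-(-2)^{-k}(k!)^{-2}\det C(X)$.
   Formalization: An orientation form δ is required to factor uniquely the n-forms on every open part of M, not only those on M itself; with M alone δ may vanish somewhere (e.g. t dt∧dy on a quotient of R² where all 2-forms are odd in t) and the claim fails. *)

(* Defs.v *)
From mathcomp Require Import all_boot all_order all_fingroup all_algebra.
From mathcomp.multinomials Require Import mpoly.

Set Implicit Arguments.
Unset Strict Implicit.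
Unset Printing Implicit Defensive.

Import GRing.Theory.
Local Open Scope ring_scope.

(* Synthetic differential geometry contradicts excluded middle, so assertions
   of the internal language cannot be read as plain Rocq propositions about a
   plain ring: together with the usual classical axioms the hypotheses would be
   inconsistent.  They are therefore interpreted by Kripke-Joyal semantics in
   the topos of sheaves on an arbitrary site.  "Sets" are sheaves, an element
   of F at stage I is an inhabitant of F I, quantifiers "for all" range over all
   later stages, and "there exists" / "or" hold locally, i.e. on a covering
   sieve (the operator [locally] below). *)

Record category := Category {
  ob :> Type;
  hom : ob -> ob -> Type;
  idm : forall I, hom I I;
  comp : forall I J K, hom J I -> hom K J -> hom K I;
  compA : forall I J K L (f : hom J I) (g : hom K J) (h : hom L K),
    comp f (comp g h) = comp (comp f g) h;
  comp1m : forall I J (f : hom J I), comp (idm I) f = f;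
  compm1 : forall I J (f : hom J I), comp f (idm J) = f
}.

Definition arrows (C : category) (I : C) := forall J : C, hom J I -> Prop.

Definition sieve (C : category) (I : C) (S : arrows I) :=
  forall J K (f : hom J I) (g : hom K J), S J f -> S K (comp f g).

Definition pullback (C : category) (I J : C) (f : hom J I) (S : arrows I)
    : arrows J :=
  fun K g => S K (comp f g).

Record site := Site {
  stages :> category;
  cover : forall I : stages, arrows I -> Prop;
  cover_sieve : forall I (S : arrows I), cover S -> sieve S;
  cover_max : forall I, @cover I (fun _ _ => True);
  cover_pullback : forall I J (f : hom J I) (S : arrows I),
    cover S -> cover (pullback f S);
  cover_trans : forall I (S T : arrows I), cover S -> sieve T ->
    (forall J (f : hom J I), S J f -> cover (pullback f T)) -> cover T
}.

Definition locally (C : site) (I : C) (Q : arrows I) : Prop :=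
  exists2 S : arrows I, cover S & forall J f, S J f -> Q J f.

Record presheaf (C : category) := Presheaf {
  sec :> C -> Type;
  res : forall I J, hom J I -> sec I -> sec J;
  res_id : forall I (x : sec I), res (idm I) x = x;
  res_comp : forall I J K (f : hom J I) (g : hom K J) (x : sec I),
    res (comp f g) x = res g (res f x)
}.

Definition is_sheaf (C : site) (F : presheaf C) : Prop :=
  forall (I : C) (S : arrows I), cover S ->
  forall s : (forall J (f : hom J I), S J f -> F J),
    (forall J K (f : hom J I) (g : hom K J) (Sf : S J f) (Sfg : S K (comp f g)),
       res g (s J f Sf) = s K (comp f g) Sfg) ->
  exists! x : F I, forall J (f : hom J I) (Sf : S J f), res f x = s J f Sf.

Definition terminal (C : category) : presheaf C :=
  @Presheaf C (fun _ => unit) (fun _ _ _ x => x)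
    (fun _ _ => erefl) (fun _ _ _ _ _ _ => erefl).

Definition yoneda (C : category) (I : C) : presheaf C :=
  @Presheaf C (fun J => hom J I) (fun J K g f => comp f g)
    (fun J f => compm1 f) (fun J K L g h f => compA f g h).

Section Family.
Variables (C : category) (F : presheaf C) (k : nat).

Definition fam_res I J (f : hom J I) (X : {ffun 'I_k -> F I})
    : {ffun 'I_k -> F J} :=
  [ffun i => res f (X i)].

Lemma fam_res_id I (X : {ffun 'I_k -> F I}) : fam_res (idm I) X = X.
Proof. by apply/ffunP=> i; rewrite ffunE res_id. Qed.

Lemma fam_res_comp I J K (f : hom J I) (g : hom K J) (X : {ffun 'I_k -> F I}) :
  fam_res (comp f g) X = fam_res g (fam_res f X).
Proof. by apply/ffunP=> i; rewrite !ffunE res_comp. Qed.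

Definition power : presheaf C := Presheaf fam_res_id fam_res_comp.

End Family.

(* The rings R I may be trivial (e.g. at stages with an empty cover), whence
   comPzRingType.  The decidable equality of R I is that of the (classical)
   metatheory and is not an internal one. *)
Record ring_presheaf (C : category) := RingPresheaf {
  rsec :> C -> comPzRingType;
  rres : forall I J, hom J I -> {rmorphism rsec I -> rsec J};
  rres_id : forall I (x : rsec I), rres (idm I) x = x;
  rres_comp : forall I J K (f : hom J I) (g : hom K J) (x : rsec I),
    rres (comp f g) x = rres g (rres f x)
}.

Definition line (C : category) (R : ring_presheaf C) : presheaf C :=
  @Presheaf C (fun I => rsec R I) (fun I J f x => rres R f x)
    (@rres_id C R) (@rres_comp C R).

Definition invertible (A : comPzRingType) (x : A) : Prop :=
  exists y : A, x * y = 1.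

Section Space.
Variables (C : category) (R : ring_presheaf C) (n : nat).

Definition vec_res I J (f : hom J I) (v : 'cV[R I]_n) : 'cV[R J]_n :=
  map_mx (rres R f) v.

Lemma vec_res_id I (v : 'cV[R I]_n) : vec_res (idm I) v = v.
Proof. by apply/matrixP=> i j; rewrite mxE rres_id. Qed.

Lemma vec_res_comp I J K (f : hom J I) (g : hom K J) (v : 'cV[R I]_n) :
  vec_res (comp f g) v = vec_res g (vec_res f v).
Proof. by apply/matrixP=> i j; rewrite !mxE rres_comp. Qed.

Definition space : presheaf C := Presheaf vec_res_id vec_res_comp.

End Space.

(* [natural_on D u]: u is an R-valued function on the part D of F, depending on
   a parameter in B.  With B = yoneda I this is a function at stage I, with
   B = terminal a global one.  Values of u outside D carry no information. *)
Definition natural_on (C : category) (R : ring_presheaf C) (B F : presheaf C)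
    (D : forall J, B J -> F J -> Prop) (u : forall J, B J -> F J -> R J) : Prop :=
  forall J K (g : hom K J) (b : B J) (x : F J), D J b x ->
    u K (res g b) (res g x) = rres R g (u J b x).

Definition in_ideal m (p : seq {mpoly int[m]}) (P : {mpoly int[m]}) : Prop :=
  exists q : nat -> {mpoly int[m]}, P = \sum_(i < size p) q i * p`_i.

(* p presents a Weil algebra Q[X_1..X_m]/(p): its maximal ideal (X_1..X_m)
   contains p and is nilpotent modulo p.  Integer coefficients suffice, up to
   the nonzero factor c that clears denominators. *)
Definition weil_presentation m (p : seq {mpoly int[m]}) : Prop :=
  (forall P, P \in p -> P@_0%MM = 0) /\
  exists N : nat, forall mu : 'X_{1..m}, mdeg mu = N ->
    exists2 c : int, c != 0 & in_ideal p (c *: 'X_[mu]).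

Definition int_eval (A : comPzRingType) m (P : {mpoly int[m]}) (x : 'cV[A]_m) : A :=
  \sum_(mu <- msupp P) (P@_mu)%:~R * \prod_(i < m) x i 0 ^+ mu i.

(* {mpoly A[m]} is only available for nontrivial A, so a polynomial over A is
   represented as a formal A-linear combination of integer polynomials, i.e.
   through the identification of A[X] with the tensor product of A and Z[X]. *)
Definition rpoly (A : comPzRingType) m := seq (A * {mpoly int[m]}).

Definition rpoly_coef (A : comPzRingType) m (F : rpoly A m) (mu : 'X_{1..m}) : A :=
  \sum_(t <- F) t.1 * (t.2@_mu)%:~R.

Definition rpoly_eval (A : comPzRingType) m (F : rpoly A m) (x : 'cV[A]_m) : A :=
  \sum_(t <- F) t.1 * int_eval t.2 x.

Definition rpoly_map (A B : comPzRingType) (f : A -> B) m (F : rpoly A m)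
    : rpoly B m :=
  [seq (f t.1, t.2) | t <- F].

Definition rpoly_congr (A : comPzRingType) m (p : seq {mpoly int[m]})
    (F G : rpoly A m) : Prop :=
  exists2 T : rpoly A m, (forall t, t \in T -> in_ideal p t.2) &
    forall mu, rpoly_coef F mu - rpoly_coef G mu = rpoly_coef T mu.

Definition zero_locus (A : comPzRingType) m (p : seq {mpoly int[m]})
    (x : 'cV[A]_m) : Prop :=
  forall P, P \in p -> int_eval P x = 0.

Definition represents (C : category) (R : ring_presheaf C) m
    (p : seq {mpoly int[m]}) (I : C)
    (u : forall J, hom J I -> 'cV[R J]_m -> R J) (F : rpoly (R I) m) : Prop :=
  forall J (h : hom J I) (x : 'cV[R J]_m), zero_locus p x ->
    u J h x = rpoly_eval (rpoly_map (rres R h) F) x.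

(* Every R-valued function on an infinitesimal object, at any stage, is given
   by a polynomial, uniquely modulo the relations defining the object.
   Polynomials modulo p being a finite free R-module, the existential need not
   be localized. *)
Definition kock_lawvere (C : category) (R : ring_presheaf C) : Prop :=
  forall m (p : seq {mpoly int[m]}), weil_presentation p ->
  forall (I : C) (u : forall J, yoneda I J -> space R m J -> R J),
    natural_on (B := yoneda I) (F := space R m)
      (fun J _ (x : 'cV[R J]_m) => zero_locus p x) u ->
  (exists F : rpoly (R I) m, represents p u F) /\
  (forall F G : rpoly (R I) m, represents p u F -> represents p u G -> rpoly_congr p F G).

Record number_line (C : site) := NumberLine {
  ring_of :> ring_presheaf C;
  line_sheaf : is_sheaf (line ring_of);
  (* [invn I m] is the (unique) inverse of m at stage I *)
  invn : forall I : C, nat -> ring_of I;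
  invnE : forall I m, (0 < m)%N -> m%:R * invn I m = 1;
  line_KL : kock_lawvere ring_of
}.

Record positivity (C : site) (R : number_line C) := Positivity {
  pos : forall I : C, R I -> Prop;
  pos_res : forall I J (f : hom J I) (x : R I), pos x -> pos (rres R f x);
  pos_local : forall I (x : R I),
    locally (fun J (f : hom J I) => pos (rres R f x)) -> pos x;
  posD : forall I (x y : R I), pos x -> pos y -> pos (x + y);
  posM : forall I (x y : R I), pos x -> pos y -> pos (x * y);
  pos_invertible : forall I (x : R I), pos x -> invertible x;
  pos_sqrt : forall I (x : R I), pos x -> exists! y : R I, pos y /\ y ^+ 2 = x;
  pos_or_neg : forall I (x : R I), invertible x ->
    locally (fun J (f : hom J I) => pos (rres R f x) \/ pos (- rres R f x))
}.

Definition multilinear (A : comPzRingType) n k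
    (phi : {ffun 'I_k -> 'cV[A]_n} -> A) : Prop :=
  forall (u : {ffun 'I_k -> 'cV[A]_n}) (i : 'I_k) (a : A) (v w : 'cV[A]_n),
    let upd z := [ffun j => if j == i then z else u j] in
    phi (upd (a *: v + w)) = a * phi (upd v) + phi (upd w).

(* R^n being finite free, the multilinear maps at stage I are exactly those
   over the ring R I, and the condition is automatically stable under change
   of stage. *)
Definition vneighbour (A : comPzRingType) n (r : nat) (x y : 'cV[A]_n) : Prop :=
  forall phi : {ffun 'I_r.+1 -> 'cV[A]_n} -> A, multilinear phi ->
    phi [ffun _ => x - y] = 0.

(* Charts are indexed by a presheaf, so that they may vary with the stage; the
   chart a identifies its domain with its image under [coord a] (values outside
   the domain are irrelevant).  A part of R^n is open when it contains, with any
   point, all its r-neighbours (for all r): this is implied by every notion of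
   open subset used in synthetic differential geometry.  [dom_open] says the
   same, in the chart a, for the overlap of the charts a and b. *)
Record manifold (C : site) (R : number_line C) (n : nat) := Manifold {
  pts :> presheaf C;
  pts_sheaf : is_sheaf pts;
  charts : presheaf C;
  dom : forall I : C, charts I -> pts I -> Prop;
  dom_res : forall I J (f : hom J I) (a : charts I) (x : pts I),
    dom a x -> dom (res f a) (res f x);
  dom_local : forall I (a : charts I) (x : pts I),
    locally (fun J (f : hom J I) => dom (res f a) (res f x)) -> dom a x;
  coord : forall I : C, charts I -> pts I -> 'cV[R I]_n;
  coord_res : forall I J (f : hom J I) (a : charts I) (x : pts I), dom a x ->
    coord (res f a) (res f x) = vec_res f (coord a x);
  coord_inj : forall I (a : charts I) (x y : pts I), dom a x -> dom a y ->
    coord a x = coord a y -> x = y;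
  image_open : forall I (a : charts I) (x : pts I) (v : 'cV[R I]_n) (r : nat),
    dom a x -> vneighbour r (coord a x) v ->
    exists2 y, dom a y & coord a y = v;
  dom_open : forall I (a b : charts I) (x y : pts I) (r : nat),
    dom a x -> dom a y -> dom b x ->
    vneighbour r (coord a x) (coord a y) -> dom b y;
  charts_cover : forall I (x : pts I),
    locally (fun J (f : hom J I) => exists a : charts J, dom a (res f x))
}.

Section Geometry.
Variables (C : site) (R : number_line C) (n : nat) (M : manifold R n).

Definition neighbour (r : nat) (I : C) (x y : M I) : Prop :=
  locally (fun J (f : hom J I) => exists a : charts M J,
    [/\ dom a (res f x), dom a (res f y) &
        vneighbour r (coord a (res f x)) (coord a (res f y))]).

Definition simplex (r k : nat) (I : C) (X : power M k.+1 I) : Prop :=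
  forall i j, neighbour r (X i) (X j).

Record open_part (B : presheaf C) := OpenPart {
  part :> forall J, B J -> M J -> Prop;
  part_res : forall J K (g : hom K J) (b : B J) (x : M J),
    part b x -> part (res g b) (res g x);
  part_local : forall J (b : B J) (x : M J),
    locally (fun K (g : hom K J) => part (res g b) (res g x)) -> part b x;
  part_open : forall J (b : B J) (x y : M J) (r : nat),
    part b x -> neighbour r x y -> part b y
}.

(* A k-form on U is a function on the 1-infinitesimal k-simplices of U; two
   forms are equal when they agree on those. *)
Definition is_form_on (B : presheaf C) (U : forall J, B J -> M J -> Prop) k
    (w : forall J, B J -> power M k.+1 J -> R J) : Prop :=
  let D J (b : B J) (X : power M k.+1 J) :=
    simplex 1 X /\ (forall i, U J b (X i)) in
  natural_on D w /\
  forall J (b : B J) (X : power M k.+1 J), D J b X ->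
  forall s : 'S_k.+1, w J b [ffun i => X (s i)] = (-1) ^+ s * w J b X.

Definition cochain k := forall J : C, power M k.+1 J -> R J.

Definition is_form k (w : cochain k) : Prop :=
  is_form_on (B := terminal C) (fun _ _ _ => True) (fun J _ => w J).

Definition is_function (f : forall J : C, M J -> R J) : Prop :=
  natural_on (B := terminal C) (F := M) (fun _ _ _ => True) (fun J _ => f J).

Definition is_extended_form k (I : C) (a : charts M I)
    (t : forall J, yoneda I J -> power M k.+1 J -> R J) : Prop :=
  let D J (h : yoneda I J) (X : power M k.+1 J) :=
    simplex 2 X /\ (forall i, dom (res h a) (X i)) in
  natural_on D t /\
  forall J (h : yoneda I J) (X : power M k.+1 J), D J h X ->
  forall i j, i != j -> X i = X j -> t J h X = 0.

Definition extends k (w : cochain k) (I : C) (a : charts M I)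
    (t : forall J, yoneda I J -> power M k.+1 J -> R J) : Prop :=
  is_extended_form a t /\
  forall J (h : yoneda I J) (X : power M k.+1 J),
    simplex 1 X -> (forall i, dom (res h a) (X i)) -> t J h X = w J X.

(* [square_value w X v] states that w^2(X) = v: X lies (locally) in a chart on
   which w has an extension, and the square at X of any extension of w to a
   chart around X is v. *)
Definition square_value k (w : cochain k) (I : C) (X : power M k.+1 I) (v : R I)
    : Prop :=
  locally (fun J (f : hom J I) => exists2 a : charts M J,
    forall i, dom a (res f (X i)) & exists t, extends w a t) /\
  forall J (f : hom J I) (a : charts M J), (forall i, dom a (res f (X i))) ->
  forall t, extends w a t -> t J (idm J) (res f X) ^+ 2 = rres R f v.

(* Forms are local objects: the defining property of an orientation form is
   required of the forms on each open part U of M (in particular on U = M), at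
   each stage.  Without bump functions in the axioms, the property for U = M
   alone would not prevent d from vanishing somewhere. *)
Definition orientation_form (d : cochain n) : Prop :=
  is_form d /\
  forall (I : C) (U : open_part (yoneda I))
         (w : forall J, yoneda I J -> power M n.+1 J -> R J),
    is_form_on U w ->
  let factors (f : forall J, yoneda I J -> M J -> R J) :=
    natural_on U f /\
    forall J (h : yoneda I J) (X : power M n.+1 J),
      simplex 1 X -> (forall i, U J h (X i)) ->
      w J h X = f J h (X ord0) * d J X in
  (exists f, factors f) /\
  forall f f', factors f -> factors f' ->
    forall J (h : yoneda I J) (x : M J), U J h x -> f J h x = f' J h x.

Definition positive_form (P : positivity R) (d w : cochain n) : Prop :=
  exists f : forall J : C, M J -> R J,
    [/\ is_function f, forall J (x : M J), pos P (f J x) &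
        forall J (X : power M n.+1 J),
          simplex 1 X -> w J X = f J (X ord0) * d J X].

Record metric := Metric {
  gval :> forall I : C, M I -> M I -> R I;
  gval_res : forall I J (f : hom J I) (x y : M I), neighbour 2 x y ->
    gval (res f x) (res f y) = rres R f (gval x y);
  gval_diag : forall I (x : M I), gval x x = 0;
  gval_sym : forall I (x y : M I), neighbour 2 x y -> gval x y = gval y x
}.

Definition metric_matrix (g : metric) (I : C) (a : charts M I)
    (G : forall J, hom J I -> M J -> 'M[R J]_n) : Prop :=
  [/\ forall J K (h : hom J I) (k : hom K J) (x : M J), dom (res h a) x ->
        G K (comp h k) (res k x) = map_mx (rres R k) (G J h x),
      forall J (h : hom J I) (x : M J), dom (res h a) x ->
        (G J h x)^T = G J h x &
      forall J (h : hom J I) (x y : M J),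
        dom (res h a) x -> dom (res h a) y -> neighbour 2 x y ->
        let z := coord (res h a) x - coord (res h a) y in
        g J x y = (z^T *m G J h x *m z) 0 0].

Definition positive_definite (I : C) (G : 'M[R I]_n) : Prop :=
  invertible (\det G) /\
  locally (fun J (f : hom J I) => exists H : 'M[R J]_n,
    map_mx (rres R f) G = H^T *m H).

Definition riemannian (g : metric) : Prop :=
  forall (I : C) (a : charts M I),
  exists2 G : forall J, hom J I -> M J -> 'M[R J]_n, metric_matrix g a G &
    forall J (h : hom J I) (x : M J), dom (res h a) x ->
      positive_definite (G J h x).

Definition cayley_menger (g : metric) k (I : C) (X : power M k.+1 I)
    : 'M[R I]_(1 + k.+1) :=
  block_mx 0 (const_mx 1) (const_mx 1) (\matrix_(i, j) g I (X i) (X j)).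

Definition heron (g : metric) k (I : C) (X : power M k.+1 I) : R I :=
  - ((- invn R I 2) ^+ k * invn R I k`! ^+ 2 * \det (cayley_menger g X)).

End Geometry.

(* Main.v *)
From HB Require Import structures.
From mathcomp Require Import all_boot all_order all_fingroup all_algebra.
From mathcomp.multinomials Require Import mpoly.
From mathcomp Require Import ring.
From Stdlib Require Import ClassicalEpsilon.
Require Import Defs.

(** Why the theorem holds.  Fix a point x in a chart and write a simplex with
    first vertex x as the n x n matrix Y of displacements of its other
    vertices.  Everything rests on counting degrees in the entries of Y: on
    r-infinitesimal simplices every product of n * r + 1 entries vanishes
    ([ord_nil]), because some row occurs r + 1 times.

    Forms.  By the Kock-Lawvere axiom a function of simplices at x is a
    polynomial in Y.  If it vanishes as soon as two vertices coincide, each of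
    its monomials meets every row, so it is an n-linear form in the rows plus
    terms of degree at least n + 1 ([leading_form]).  On 1-infinitesimal
    simplices these extra terms vanish and products of entries from distinct
    rows alternate, whence an n-form is D * det Y for a scalar D, its density
    ([form_eq_diag], [form_density]).  On 2-infinitesimal simplices the n-linear
    part is itself a multiple of det Y: this is seen on the degenerate simplices
    whose distinct vertices move independently, to first order, away from a
    common centre ([extended_form_leading]).  Squaring pushes the extra terms to degree
    2 n + 1, where they vanish; so the square of any extension of an n-form
    with density D is D ^ 2 * (det Y) ^ 2 ([extension_sqr]).

    Heron.  The Cayley-Menger determinant of n + 1 points reduces to an n x n
    determinant in the quantities g(x_i,x_j) - g(x_i,x) - g(x,x_j).  Replacing
    the matrices G(x_i) by G(x) changes each g(x_i,x_j) by terms of degree 3,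
    hence the determinant by terms of degree 2 n + 1, which vanish; what
    remains is the Gram determinant det (Y G Y^T), so that Heron equals
    det G(x) * (det Y) ^ 2 / (n!) ^ 2 ([heron_det]).

    Conclusion.  A form f * d therefore has square Heron exactly when
    f ^ 2 = det G / (n! * D) ^ 2, since (det Y) ^ 2 may be cancelled on
    2-infinitesimal simplices ([det_sqr_cancel]).  The orientation hypothesis
    makes D invertible ([density_invertible]) and G is locally of the form
    H^T H, so the right-hand side is the square of an invertible element and
    has exactly one positive square root f(x).  Uniqueness makes the
    local values of f agree, and they glue to a function on M because the line
    is a sheaf. *)

Set Implicit Arguments.
Unset Strict Implicit.
Unset Printing Implicit Defensive.

Import GRing.Theory.
Local Open Scope ring_scope.

(** * Orders of vanishing *)

Section Order.
Variable A : comPzRingType.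
Implicit Types (E : A -> Prop) (z w : A).

(** [order_ge E d z]: z lies in the ideal generated by the products of d
    elements of E. *)
Inductive order_ge E : nat -> A -> Prop :=
| ord_any z : order_ge E 0 z
| ord_zero d : order_ge E d 0
| ord_add d z w : order_ge E d z -> order_ge E d w -> order_ge E d (z + w)
| ord_gen d e z : E e -> order_ge E d z -> order_ge E d.+1 (e * z).

Lemma ord_mul E d z c : order_ge E d z -> order_ge E d (c * z).
Proof.
elim=> {d z} [z|d|d z w _ IHz _ IHw|d e z Ee _ IH].
- exact: ord_any.
- rewrite mulr0; exact: ord_zero.
- rewrite mulrDr; exact: ord_add.
- rewrite mulrCA; exact: ord_gen.
Qed.

Lemma ord_opp E d z : order_ge E d z -> order_ge E d (- z).
Proof. by rewrite -mulN1r; apply: ord_mul. Qed.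

Lemma ordM E d e z w : order_ge E d z -> order_ge E e w -> order_ge E (d + e) (z * w).
Proof.
move=> Hz Hw; elim: Hz => {d z} [z|d|d z z' _ IHz _ IHz'|d c z Ec _ IH].
- exact: ord_mul.
- rewrite mul0r; exact: ord_zero.
- rewrite mulrDl; exact: ord_add.
- rewrite -mulrA addSn; exact: ord_gen.
Qed.

Lemma ord_leq E d e z : (d <= e)%N -> order_ge E e z -> order_ge E d z.
Proof.
move=> le Hz; elim: Hz d le => {e z} [z|e|e z w _ IHz _ IHw|e c z Ec _ IH] d.
- by rewrite leqn0 => /eqP ->; apply: ord_any.
- move=> _; exact: ord_zero.
- move=> le; apply: ord_add; [exact: IHz|exact: IHw].
- case: d => [_|d le]; first exact: ord_any.
  by apply: ord_gen => //; apply: IH.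
Qed.

Lemma ord_elt E e : E e -> order_ge E 1 e.
Proof. by move=> Ee; rewrite -[e]mulr1; apply: ord_gen => //; apply: ord_any. Qed.

Lemma ord_sum E d (I : Type) (s : seq I) (Q : pred I) (F : I -> A) :
  (forall i, Q i -> order_ge E d (F i)) -> order_ge E d (\sum_(i <- s | Q i) F i).
Proof. by move=> H; apply: big_ind => //; [exact: ord_zero|exact: ord_add]. Qed.

Lemma ord_prod E (I : Type) (s : seq I) (d : I -> nat) (F : I -> A) :
  (forall i, order_ge E (d i) (F i)) ->
  order_ge E (\sum_(i <- s) d i)%N (\prod_(i <- s) F i).
Proof.
move=> H; elim: s => [|i s IH]; first by rewrite !big_nil; apply: ord_any.
by rewrite !big_cons; apply: ordM.
Qed.

Lemma ord_trans E E' d z :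
  (forall e, E e -> order_ge E' 1 e) -> order_ge E d z -> order_ge E' d z.
Proof.
move=> H; elim=> {d z} [z|d|d z w _ IHz _ IHw|d e z Ee _ IH].
- exact: ord_any.
- exact: ord_zero.
- exact: ord_add.
- by rewrite -add1n; apply: ordM => //; apply: H.
Qed.

Lemma ord_kill E d z c :
  order_ge E d z ->
  (forall s : seq A, size s = d -> (forall e, e \in s -> E e) ->
     c * \prod_(e <- s) e = 0) ->
  c * z = 0.
Proof.
move=> Hz; elim: Hz c => {d z} [z|d|d z w _ IHz _ IHw|d e z Ee _ IH] c H.
- by have := H [::] erefl; rewrite big_nil mulr1 => -> //; rewrite mul0r.
- by rewrite mulr0.
- by rewrite mulrDr IHz // IHw // addr0.
- rewrite mulrA; apply: IH => s sz Es; rewrite -mulrA.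
  have := H (e :: s); rewrite big_cons; apply; first by rewrite /= sz.
  by move=> e'; rewrite inE => /orP[/eqP ->//|]; apply: Es.
Qed.

End Order.

Definition entries (A : comPzRingType) k n (Y : 'M[A]_(k, n)) (z : A) : Prop :=
  exists i a, z = Y i a.

Definition row_nil (A : comPzRingType) r k n (Y : 'M[A]_(k, n)) : Prop :=
  forall i (al : 'I_r.+1 -> 'I_n), \prod_j Y i (al j) = 0.

Definition row_diff_nil (A : comPzRingType) r k n (Y : 'M[A]_(k, n)) : Prop :=
  forall i i' (al : 'I_r.+1 -> 'I_n), \prod_j (Y i (al j) - Y i' (al j)) = 0.

(** The rows of Y are the displacements from the first vertex to the other
    vertices of an r-infinitesimal simplex in R^n: the rows and their
    differences are r-infinitesimal vectors. *)
Definition simplex_mx (A : comPzRingType) r k n (Y : 'M[A]_(k, n)) : Prop :=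
  row_nil r Y /\ row_diff_nil r Y.

Lemma ord_entry (A : comPzRingType) k n (Y : 'M[A]_(k, n)) i a :
  order_ge (entries Y) 1 (Y i a).
Proof. by apply: ord_elt; exists i, a. Qed.

Lemma sum_count_fst (I T : finType) (s : seq (I * T)) :
  (\sum_i count (fun p => p.1 == i) s = size s)%N.
Proof.
elim: s => [|p s IH] /=; first by rewrite big1.
rewrite big_split /= IH (bigD1 p.1) //= eqxx big1 // => i /negPf ne.
by rewrite eq_sym ne.
Qed.

(** Pigeonhole: among k * r + 1 entries of a matrix with k rows, r + 1 lie in
    the same row, and their product is zero. *)
Lemma ord_nil (A : comPzRingType) r k n (Y : 'M[A]_(k, n)) z :
  row_nil r Y -> order_ge (entries Y) (k * r).+1 z -> z = 0.
Proof.
move=> nilY Hz; rewrite -[z]mul1r; apply: (ord_kill Hz) => s sz Es.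
rewrite mul1r.
have [t st] : exists t : seq ('I_k * 'I_n), s = [seq Y p.1 p.2 | p <- t].
  elim: s Es {sz} => [|e s IH] Es; first by exists [::].
  have [t ->] : exists t : seq ('I_k * 'I_n), s = [seq Y p.1 p.2 | p <- t].
    by apply: IH => e' He'; apply: Es; rewrite inE He' orbT.
  have [i [a ->]] : entries Y e by apply: Es; rewrite inE eqxx.
  by exists ((i, a) :: t).
have [i ci] : exists i, (r < count (fun p => p.1 == i) t)%N.
  apply/existsP; apply: contraT; rewrite negb_exists => /forallP H.
  have : (size t <= k * r)%N.
    have -> : (k * r = \sum_(i < k) r)%N by rewrite sum_nat_const card_ord.
    by rewrite -sum_count_fst; apply: leq_sum => i _; rewrite leqNgt H.
  by rewrite -(size_map (fun p : 'I_k * 'I_n => Y p.1 p.2)) -st sz ltnn.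
rewrite st big_map (bigID (fun p => p.1 == i)) /= -big_filter.
set f := filter _ _.
have sf : (r.+1 <= size f)%N by rewrite size_filter.
have allf : all (fun p => p.1 == i) f by rewrite filter_all.
suff -> : \prod_(p <- f) Y p.1 p.2 = 0 by rewrite mul0r.
rewrite -(cat_take_drop r.+1 f) big_cat /=.
have stk : size (take r.+1 f) = r.+1 by rewrite size_take_min; apply/minn_idPl.
have p0 : 'I_k * 'I_n by case: (f) sf.
have -> : \prod_(p <- take r.+1 f) Y p.1 p.2
        = \prod_(j < r.+1) Y i (nth p0 (take r.+1 f) j).2.
  rewrite (big_nth p0) stk big_mkord; apply: eq_bigr => j _.
  have : nth p0 (take r.+1 f) j \in f.
    by apply: (mem_take (n0 := r.+1)); rewrite mem_nth // stk.
  by move=> /(allP allf)/eqP ->.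
by rewrite nilY mul0r.
Qed.

(** * Alternating families and 1-infinitesimal simplices *)

Section Alternating.
Variables (A : comPzRingType) (n : nat).
Hypothesis add_self_eq0 : forall z : A, z + z = 0 -> z = 0.

Definition alternating (F : {ffun 'I_n -> 'I_n} -> A) :=
  forall i j, i != j -> forall al : {ffun 'I_n -> 'I_n}, F [ffun k => al (tperm i j k)] = - F al.

Lemma alternating_ninj F (al : {ffun 'I_n -> 'I_n}) :
  alternating F -> ~~ injectiveb al -> F al = 0.
Proof.
move=> altF /injectivePn [i [j ne e]]; apply: add_self_eq0.
have := altF i j ne al; have -> : [ffun k => al (tperm i j k)] = al.
  by apply/ffunP=> k; rewrite ffunE; case: tpermP => [->|->|].
by move=> E; rewrite {1}E addNr.
Qed.

Lemma alternating_perm F (s : 'S_n) :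
  alternating F -> F [ffun k => s k] = (-1) ^+ s * F [ffun k => k].
Proof.
move=> altF; have [ts -> tsP] := prod_tpermP s.
elim: ts tsP => [_|[i j] ts IH /= /andP[ne tsP]].
  by rewrite big_nil odd_perm1 mul1r; congr F; apply/ffunP=> k; rewrite !ffunE perm1.
rewrite big_cons odd_permM odd_tperm ne signr_addb /= expr1 mulN1r mulNr -IH //.
rewrite -(altF i j) //; congr F.
by apply/ffunP=> k; rewrite !ffunE permM.
Qed.

Lemma sum_ffun_perm (F : {ffun 'I_n -> 'I_n} -> A) :
  (forall al : {ffun 'I_n -> 'I_n}, ~~ injectiveb al -> F al = 0) ->
  \sum_al F al = \sum_(s : 'S_n) F [ffun k => s k].
Proof.
move=> F0; rewrite (bigID (fun al : {ffun 'I_n -> 'I_n} => injectiveb al)) /=.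
rewrite [X in _ + X]big1 ?addr0 //.
rewrite (reindex (fun s : 'S_n => pval s)) /=; last first.
  exists (insubd (1%g : 'S_n)) => [s|al] /= inj; first by rewrite valKd.
  by rewrite insubdK.
apply: eq_big => [s|s _]; first by rewrite (valP s).
by congr F; apply/ffunP=> k; rewrite ffunE pvalE.
Qed.

(** An alternating family of coefficients is determined by its value at the
    identity, and the associated multilinear form is the Leibniz formula. *)
Lemma alternating_det F (Y : 'M[A]_n) : alternating F ->
  \sum_al F al * \prod_i Y i (al i) = F [ffun k => k] * \det Y.
Proof.
move=> altF; rewrite sum_ffun_perm => [|al /(alternating_ninj altF) ->]; last by rewrite mul0r.
rewrite /determinant big_distrr /=; apply: eq_bigr => s _.
rewrite alternating_perm // mulrCA -mulrA; congr (_ * (_ * _)).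
by apply: eq_bigr => i _; rewrite ffunE.
Qed.

(** Once the squares of the rows vanish, the vanishing of the square of
    Y_i - Y_j polarises to antisymmetry. *)
Lemma simplex1_rel (Y : 'M[A]_n) i j a b : simplex_mx 1 Y ->
  Y i a * Y i b = 0 /\ Y i a * Y j b = - (Y j a * Y i b).
Proof.
case=> rn dn.
have R i' a' b' : Y i' a' * Y i' b' = 0.
  have := rn i' (fun k => if k == ord0 then a' else b').
  by rewrite 2!big_ord_recl big_ord0 /= mulr1.
split=> //; apply/eqP; rewrite -addr_eq0; apply/eqP.
have := dn i j (fun k => if k == ord0 then a else b).
rewrite 2!big_ord_recl big_ord0 /= mulr1 mulrBl !mulrBr !R.
by rewrite sub0r subr0 -opprD => /eqP; rewrite oppr_eq0 => /eqP.
Qed.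

Lemma simplex1_alternating (Y : 'M[A]_n) : simplex_mx 1 Y ->
  alternating (fun al : {ffun 'I_n -> 'I_n} => \prod_i Y i (al i)).
Proof.
move=> sY i j ne al.
rewrite (bigD1 i) //= (bigD1 j) 1?eq_sym //= [in RHS](bigD1 i) //=.
rewrite [X in - (_ * X)](bigD1 j) 1?eq_sym //= !ffunE tpermL tpermR !mulrA -mulNr.
congr (_ * _).
  by have [_ ->] := simplex1_rel i j (al j) (al i) sY; congr (- _); rewrite mulrC.
by apply: eq_bigr => k /andP[ni nj]; rewrite ffunE tpermD // eq_sym.
Qed.

Lemma simplex1_det (Y : 'M[A]_n) : simplex_mx 1 Y -> \det Y = (n`!)%:R * \prod_i Y i i.
Proof.
move=> sY; rewrite /determinant.
transitivity (\sum_(s : 'S_n) \prod_i Y i i); last first.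
  by rewrite sumr_const card_Sn mulr_natl.
apply: eq_bigr => s _.
have -> : \prod_i Y i (s i) = \prod_i Y i ([ffun k => s k] i).
  by apply: eq_bigr => i _; rewrite ffunE.
rewrite (alternating_perm s (simplex1_alternating sY)) mulrA -signr_addb addbb mul1r.
by apply: eq_bigr => i _; rewrite ffunE.
Qed.

(** Exchanging the values of two permutations s and t on a set S, when the
    results are still permutations, preserves the product of their signs:
    conjugated to s = 1, it cuts t into its parts on S and off S. *)
Lemma mixed_sign (s t : 'S_n) (S : {set 'I_n}) (al be : 'S_n) :
  (forall i, al i = if i \in S then s i else t i) ->
  (forall i, be i = if i \in S then t i else s i) ->
  odd_perm al (+) odd_perm be = odd_perm s (+) odd_perm t.
Proof.
move=> Ha Hb.
have st i : i \in S -> (s^-1)%g (t i) \in S.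
  move=> iS; apply: contraT => nS; have := Hb i; rewrite iS.
  have := Hb ((s^-1)%g (t i)); rewrite (negPf nS) permKV => <- /perm_inj E.
  by rewrite -E iS in nS.
have E : (be * s^-1 * (al * s^-1) = t * s^-1)%g.
  apply/permP => i; rewrite !permM Hb; case: ifP => iS.
    by rewrite Ha st // permKV.
  by rewrite permK Ha iS.
have := congr1 (@odd_perm _) E; rewrite !odd_permM !odd_permV.
by case: (odd_perm al); case: (odd_perm be); case: (odd_perm s); case: (odd_perm t).
Qed.

(** The sum of two independent 1-infinitesimal simplices is a 2-infinitesimal
    one, rich enough for the square of the determinant to survive.  Expanding
    over pairs (s, t) of permutations and over the set S of rows where s is
    used in Y, all surviving terms have sign +1 by [mixed_sign], and the term
    s = t = 1, S empty does survive, so no cancellation occurs. *)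
Lemma det_sqr_sum (Y Z : 'M[A]_n) : simplex_mx 1 Y -> simplex_mx 1 Z ->
  exists2 N : nat, (0 < N)%N &
    \det (Y + Z) ^+ 2 = N%:R * (\prod_i Y i i * \prod_i Z i i).
Proof.
move=> sY sZ.
(* With s chosen on S and t elsewhere, mix s t S lists the columns used by the
   entries of Y and mix t s S those used by the entries of Z. *)
pose mix (s t : 'S_n) (S : {set 'I_n}) := [ffun i => if i \in S then s i else t i].
pose ok s t S := injectiveb (mix s t S) && injectiveb (mix t s S).
exists (\sum_s \sum_t \sum_S ok s t S)%N.
  rewrite (bigD1 1%g) //= (bigD1 1%g) //= (bigD1 set0) //=.
  suff -> : ok 1%g 1%g set0 by []; rewrite /ok.
  have -> : forall b, b && b = b by case.
  apply/injectiveP => i j; rewrite !ffunE !inE; exact: perm_inj.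
rewrite expr2 /determinant big_distrlr /= natr_sum big_distrl /=.
apply: eq_bigr => s _; rewrite natr_sum big_distrl /=; apply: eq_bigr => t _.
rewrite mulrACA -big_split /= natr_sum big_distrl /=.
have -> : \prod_i ((Y + Z) i (s i) * (Y + Z) i (t i))
   = \prod_i (Y i (s i) * Z i (t i) + Y i (t i) * Z i (s i)).
  apply: eq_bigr => i _; rewrite !mxE mulrDl !mulrDr.
  have [-> _] := simplex1_rel i i (s i) (t i) sY.
  have [-> _] := simplex1_rel i i (s i) (t i) sZ.
  by rewrite add0r addr0 [Z i (s i) * _]mulrC.
rewrite bigA_distr big_distrr /=; apply: eq_bigr => S _.
have -> : \prod_i (if i \in S then Y i (s i) * Z i (t i) else Y i (t i) * Z i (s i))
   = \prod_i Y i (mix s t S i) * \prod_i Z i (mix t s S i).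
  by rewrite -big_split; apply: eq_bigr => i _; rewrite !ffunE; case: ifP.
have [/andP[/injectiveP ia /injectiveP ib]|] := boolP (ok s t S); last first.
  rewrite negb_and mul0r => /orP [] /alternating_ninj H.
    by rewrite (H _ (simplex1_alternating sY)) mul0r mulr0.
  by rewrite (H _ (simplex1_alternating sZ)) !mulr0.
have Ea : mix s t S = [ffun i => perm ia i] by apply/ffunP=> i; rewrite [RHS]ffunE permE.
have Eb : mix t s S = [ffun i => perm ib i] by apply/ffunP=> i; rewrite [RHS]ffunE permE.
rewrite {1}Ea Eb (alternating_perm _ (simplex1_alternating sY)).
rewrite (alternating_perm _ (simplex1_alternating sZ)) [X in _ * X = _]mulrACA [LHS]mulrA -!signr_addb.
rewrite -(@mixed_sign s t S (perm ia) (perm ib)).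
- rewrite addbb expr0 [LHS]mul1r [RHS]mul1r; congr (_ * _); apply: eq_bigr => i _; first by rewrite ffunE.
  by rewrite ffunE.
- by move=> i; rewrite permE ffunE.
- by move=> i; rewrite permE ffunE.
Qed.

End Alternating.

(** * Determinants of simplices *)

Section Determinants.
Variable A : comPzRingType.

Definition diff_mx k n (v : 'I_k.+1 -> 'cV[A]_n) : 'M[A]_(k, n) :=
  \matrix_(i, a) (v (lift ord0 i) a 0 - v ord0 a 0).

Definition shear n : 'M[A]_(1 + n) := block_mx 1%:M 0 (const_mx (-1)) 1%:M.

Lemma det_shear n : \det (shear n) = 1.
Proof. by rewrite det_lblock !det1 mulr1. Qed.

Lemma lshift_ord1 n (i : 'I_1) : lshift n i = ord0 :> 'I_n.+1.
Proof. by apply/val_inj; rewrite /= ord1. Qed.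

(** The determinant of the displacements is that of the affine coordinates
    (1, v_i), in which all vertices play the same role; alternation with
    respect to all n + 1 vertices follows. *)
Lemma det_diff_mx n (v : 'I_n.+1 -> 'cV[A]_n) :
  \det (diff_mx v) =
  \det (\matrix_(i < 1 + n, j < 1 + n) if unlift ord0 j is Some a then v i a 0 else 1).
Proof.
set Q := \matrix_(i, j) _.
have -> : Q = block_mx 1%:M (\row_a v ord0 a 0) (const_mx 1)
                (\matrix_(i, a) v (lift ord0 i) a 0).
  rewrite -[Q]submxK; congr block_mx; apply/matrixP => i j;
    rewrite !mxE ?lshift_ord1 ?rshift1 ?unlift_none ?liftK //.
  by rewrite !ord1.
set B := block_mx _ _ _ _.
have -> : \det B = \det (shear n *m B) by rewrite det_mulmx det_shear mul1r.
rewrite mulmx_block !mul1mx !mul0mx !addr0.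
have -> : const_mx (-1) *m 1%:M + const_mx 1 = 0 :> 'cV[A]_n.
  by rewrite mulmx1; apply/matrixP => i j; rewrite !mxE addNr.
rewrite det_ublock det1 mul1r; congr (\det _); apply/matrixP => i a.
by rewrite !mxE big_ord1 !mxE mulN1r addrC.
Qed.

Lemma det_diff_mx_perm n (v : 'I_n.+1 -> 'cV[A]_n) (s : 'S_n.+1) :
  \det (diff_mx (fun i => v (s i))) = (-1) ^+ s * \det (diff_mx v).
Proof.
rewrite !det_diff_mx -det_perm -det_mulmx -row_permE; congr (\det _).
by apply/matrixP => i j; rewrite !mxE.
Qed.

(** Subtracting the first row and column of g from the others clears the
    border up to a 2 x 2 antidiagonal block of determinant -1. *)
Lemma det_bordered n (g : 'M[A]_(1 + n)) :
  \det (block_mx 0 (const_mx 1) (const_mx 1) g : 'M[A]_(1 + (1 + n))) =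
  - \det (\matrix_(i, j) (g (lift ord0 i) (lift ord0 j) - g (lift ord0 i) ord0
                          - g ord0 (lift ord0 j) + g ord0 ord0)).
Proof.
pose J : 'cV[A]_n := const_mx 1.
pose W : 'M[A]_(1 + (1 + n)) := block_mx 1%:M 0 0 (shear n).
(* T1 T2 T1 turns the first two coordinates by a quarter turn; written as a
     product of unipotent matrices it visibly has determinant 1. *)
pose T1 : 'M[A]_(1 + (1 + n)) := block_mx 1%:M (row_mx 1%:M 0) 0 1%:M.
pose T2 : 'M[A]_(1 + (1 + n)) := block_mx 1%:M 0 (col_mx (-1%:M) 0) 1%:M.
have dW : \det W = 1 by rewrite det_ublock det1 det_shear mulr1.
have dT1 : \det T1 = 1 by rewrite det_ublock !det1 mulr1.
have dT2 : \det T2 = 1 by rewrite det_lblock !det1 mulr1.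
have shJ : shear n *m const_mx 1 = col_mx 1%:M 0 :> 'cV[A]_(1 + n).
  have -> : const_mx 1 = col_mx 1%:M J :> 'cV[A]_(1 + n).
    by rewrite -[LHS]vsubmxK; congr col_mx; apply/matrixP => i j; rewrite !mxE ?ord1.
  rewrite mul_block_col !mul1mx mul0mx addr0 mulmx1; congr col_mx.
  by apply/matrixP => i j; rewrite !mxE addNr.
have shJt : const_mx 1 *m (shear n)^T = row_mx 1%:M 0 :> 'rV[A]_(1 + n).
  apply: trmx_inj; rewrite trmx_mul trmxK trmx_const shJ.
  by rewrite tr_row_mx trmx1 trmx0.
pose h := shear n *m g *m (shear n)^T.
have E1 : W *m (block_mx 0 (const_mx 1) (const_mx 1) g) *m W^T =
    block_mx 0 (row_mx 1%:M 0) (col_mx 1%:M 0) h.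
  rewrite tr_block_mx !mulmx_block !trmx0 !trmx1.
  by rewrite !(mul0mx, mulmx0, mul1mx, mulmx1, addr0, add0r) shJ shJt.
have E2 : T1 *m T2 *m T1 =
    block_mx 0 (row_mx 1%:M 0) (col_mx (-1%:M) 0) (block_mx 0 0 0 1%:M).
  rewrite !mulmx_block !(mul0mx, mulmx0, mul1mx, mulmx1, addr0, add0r).
  rewrite mul_row_col mulmx0 addr0 mul1mx mul_col_row.
  rewrite !(mul0mx, mulmx0, mul1mx, mulmx1, addr0, add0r) subrr.
  rewrite (_ : 1%:M = block_mx 1%:M 0 0 1%:M :> 'M[A]_(1 + n)) ?scalar_mx_block //.
  by rewrite mul0mx add0r add_block_mx !addr0 addNr add0r.
have E3 : block_mx 0 (row_mx 1%:M 0) (col_mx 1%:M 0) h *m (T1 *m T2 *m T1) =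
    block_mx (-1%:M) 0 (h *m col_mx (-1%:M) 0)
      (block_mx 1%:M (ursubmx h) 0 (drsubmx h)).
  rewrite E2 mulmx_block !(mul0mx, add0r) mul_row_col mulmx0 addr0 mul1mx.
  rewrite mul_row_block mul_col_row.
  rewrite !(mulmx0, mul0mx, mulmx1, mul1mx, addr0, add0r).
  congr block_mx; first by rewrite row_mx0.
  rewrite -{1}[h]submxK mulmx_block !(mulmx0, mul0mx, mulmx1, mul1mx, addr0, add0r).
  by rewrite add_block_mx !(addr0, add0r).
have -> : \det (block_mx 0 (const_mx 1) (const_mx 1) g : 'M[A]_(1 + (1 + n))) =
   \det ((W *m (block_mx 0 (const_mx 1) (const_mx 1) g) *m W^T) *m (T1 *m T2 *m T1)).
  by rewrite !det_mulmx det_tr dW dT1 dT2 !mulr1 mul1r.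
rewrite E1 E3 det_lblock det_ublock det1 mul1r.
rewrite (_ : \det (- 1%:M) = -1) ?mulN1r; last by rewrite det_mx11 !mxE.
congr (- \det _); apply/matrixP => i j.
rewrite /h -{1}[g]submxK /shear tr_block_mx trmx_const !trmx1 trmx0 !mulmx_block.
rewrite !(mulmx0, mul0mx, mulmx1, mul1mx, addr0, add0r) block_mxKdr !mxE.
rewrite !big_ord1 !mxE !big_ord1 !mxE !rshift1 ?lshift_ord1.
ring.
Qed.

Lemma ord_det n (Y : 'M[A]_n) : order_ge (entries Y) n (\det Y).
Proof.
apply: ord_sum => s _; apply: ord_mul.
have := ord_prod (E := entries Y) (index_enum 'I_n) (d := fun _ => 1%N)
  (F := fun i => Y i (s i)) (fun i => ord_entry Y i (s i)).
by rewrite sum1_card card_ord.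
Qed.

(** Degree count in the Leibniz formula: a product of n factors of order a, one
    of which is replaced by a term of order a + 1, has order n * a + 1. *)
Lemma ord_det_add E n (X Z : 'M[A]_n) a :
  (forall i j, order_ge E a (X i j)) -> (forall i j, order_ge E a.+1 (Z i j)) ->
  exists2 z, order_ge E (n * a).+1 z & \det (X + Z) = \det X + z.
Proof.
move=> HX HZ.
have P (s : 'S_n) : exists2 z, order_ge E (n * a).+1 z &
    \prod_i (X + Z) i (s i) = \prod_i X i (s i) + z.
  have : forall r : seq 'I_n, exists2 z, order_ge E (size r * a).+1 z &
      \prod_(i <- r) (X + Z) i (s i) = \prod_(i <- r) X i (s i) + z.
    elim=> [|i r [z Hz e]].
      by exists 0; [exact: ord_zero | rewrite !big_nil addr0].
    have Hr : order_ge E (size r * a) (\prod_(i <- r) X i (s i)).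
      have := ord_prod (E := E) r (d := fun _ => a) (F := fun i => X i (s i)) (fun i => HX i _).
      by rewrite big_const_seq count_predT iter_addn_0 mulnC.
    exists (X i (s i) * z + Z i (s i) * (\prod_(i <- r) X i (s i) + z)); last first.
      by rewrite !big_cons e !mxE; ring.
    rewrite /= mulSn; apply: ord_add.
      by rewrite -addnS; apply: ordM.
    rewrite -addSn; apply: ordM => //; apply: ord_add => //.
    exact: ord_leq Hz.
  move=> /(_ (index_enum 'I_n)); rewrite (_ : size _ = n) //.
  by rewrite -sum1_size sum1_card card_ord.
have /fin_all_exists [f Hf] (s : 'S_n) : exists z, order_ge E (n * a).+1 z /\
    \prod_i (X + Z) i (s i) = \prod_i X i (s i) + z.
  by have [z ? ?] := P s; exists z.
exists (\sum_(s : 'S_n) (-1) ^+ s * f s).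
  by apply: ord_sum => s _; apply: ord_mul; case: (Hf s).
rewrite /determinant -big_split /=; apply: eq_bigr => s _.
by have [_ ->] := Hf s; rewrite mulrDr.
Qed.

End Determinants.

(** * The Kock-Lawvere axiom *)

(** Evaluation of integer polynomials is a ring morphism.  Over a nontrivial
    ring it is the evaluation morphism of polynomials; over the zero ring there
    is nothing to prove. *)
Lemma int_eval_spec (A : comPzRingType) m (x : 'cV[A]_m) :
  [/\ forall P Q, int_eval (P - Q) x = int_eval P x - int_eval Q x,
      forall P Q, int_eval (P * Q) x = int_eval P x * int_eval Q x,
      int_eval 1 x = 1 &
      forall mu : 'X_{1..m}, int_eval 'X_[mu] x = \prod_i x i 0 ^+ mu i].
Proof.
have [t|nt] := eqVneq (1 : A) 0.
  have tr (a b : A) : a = b by rewrite -[a]mulr1 -[b]mulr1 t !mulr0.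
  by split=> *; apply: tr.
pose B : comNzRingType := HB.pack A (GRing.PzSemiRing_isNonZero.Build A nt).
have E (P : {mpoly int[m]}) : int_eval P x =
    mmap (intr : int -> B) (fun i => x i 0 : B) P by [].
split=> [P Q|P Q||mu]; rewrite !E.
- exact: (@raddfB _ B (mmap (intr : int -> B) (fun i => x i 0 : B)) P Q).
- exact: (@rmorphM _ B (mmap (intr : int -> B) (fun i => x i 0 : B)) P Q).
- exact: (@rmorph1 _ B (mmap (intr : int -> B) (fun i => x i 0 : B))).
- exact: (@mmapX _ _ B (fun i => x i 0 : B) intr mu).
Qed.

Lemma int_evalXU (A : comPzRingType) m (x : 'cV[A]_m) i :
  int_eval 'X_i x = x i 0.
Proof.
have [_ _ _ ->] := int_eval_spec x.
rewrite (bigD1 i) //= mnm1E eqxx expr1 big1 ?mulr1 // => j ne.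
by rewrite mnm1E eq_sym (negPf ne) expr0.
Qed.

Lemma int_eval_prod (A : comPzRingType) m (x : 'cV[A]_m) (I : Type) (s : seq I)
    (F : I -> {mpoly int[m]}) :
  int_eval (\prod_(i <- s) F i) x = \prod_(i <- s) int_eval (F i) x.
Proof.
have [_ hM h1 _] := int_eval_spec x.
by elim: s => [|i s IH]; rewrite ?big_nil // !big_cons hM IH.
Qed.

Lemma in_idealM m (p : seq {mpoly int[m]}) P Q : P \in p -> in_ideal p (Q * P).
Proof.
move=> Pp; have ip : (index P p < size p)%N by rewrite index_mem.
exists (fun i => if i == index P p then Q else 0).
rewrite (bigD1 (Ordinal ip)) //= eqxx nth_index // big1 ?addr0 // => i ne.
case: eqP => [e|_]; last by rewrite mul0r.
by case/eqP: ne; apply/val_inj.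
Qed.

(** If a power s of each variable is among the equations, a monomial of degree
    m * s + 1 is divisible by one of these powers. *)
Lemma weil_presentation_pow m (p : seq {mpoly int[m]}) s :
  (forall P, P \in p -> P@_0%MM = 0) -> (forall v, 'X_v ^+ s \in p) ->
  weil_presentation p.
Proof.
move=> p0 pX; split=> //; exists (m * s).+1 => mu dmu; exists 1 => //.
have [v sv] : exists v, (s <= mu v)%N.
  apply/existsP; apply: contraT; rewrite negb_exists => /forallP H.
  have : (mdeg mu <= m * s)%N.
    have -> : (m * s = \sum_(i < m) s)%N by rewrite sum_nat_const card_ord.
    by rewrite mdegE; apply: leq_sum => i _; rewrite leqNgt; apply: contra (H i) => /ltnW.
  by rewrite dmu ltnn.
rewrite scale1r; have -> : mu = (mu - U_(v) *+ s + U_(v) *+ s)%MM.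
  rewrite submK //; apply/mnm_lepP => i; rewrite mulmnE mnm1E.
  by case: eqP => [<-|_]; rewrite ?mul1n ?mul0n.
by rewrite mpolyXD -mpolyXn; apply: in_idealM.
Qed.

Section KockLawvere.
Variables (C : site) (R : number_line C).

(** Existence half of the Kock-Lawvere axiom, with the polynomial flattened to
    a list of monomials with coefficients in R. *)
Lemma kl_exists m (p : seq {mpoly int[m]}) (I : C)
    (u : forall J, yoneda I J -> space R m J -> R J) :
  weil_presentation p ->
  natural_on (B := yoneda I) (F := space R m)
    (fun J _ (x : 'cV[R J]_m) => zero_locus p x) u ->
  exists s : seq (R I * ('I_m -> nat)), forall J (h : hom J I) (x : 'cV[R J]_m),
    zero_locus p x ->
    u J h x = \sum_(t <- s) rres R h t.1 * \prod_v x v 0 ^+ t.2 v.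
Proof.
move=> wp nu; have [[F HF] _] := line_KL wp nu.
exists (flatten [seq [seq (t.1 * (t.2@_mu)%:~R, fun v => mu v) | mu <- msupp t.2] | t <- F]).
move=> J h x zx; rewrite HF // /rpoly_eval big_map big_flatten /= big_map.
apply: eq_bigr => t _; rewrite big_map /int_eval big_distrr /=.
by apply: eq_bigr => mu _; rewrite mulrA rmorphM rmorph_int.
Qed.

(** Integer combinations of coefficient functionals: they make sense for
    polynomials over every R at once. *)
Definition coef_comb m (M : seq (int * 'X_{1..m})) (P : {mpoly int[m]}) : int :=
  \sum_(e <- M) e.1 * P@_e.2.

Lemma coef_combD m (M : seq (int * 'X_{1..m})) P Q :
  coef_comb M (P + Q) = coef_comb M P + coef_comb M Q.
Proof.
by rewrite /coef_comb -big_split; apply: eq_bigr => e _ /=; rewrite mcoeffD mulrDr.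
Qed.

(** Uniqueness half of the Kock-Lawvere axiom, in dual form: a coefficient
    c with c * x^mu = 0 on the whole object must vanish if some functional kills
    the defining ideal but takes the value 1 on x^mu. *)
Lemma kl_cancel m (p : seq {mpoly int[m]}) (M : seq (int * 'X_{1..m}))
    (mu : 'X_{1..m}) (I : C) (c : R I) :
  weil_presentation p ->
  (forall P Q, P \in p -> coef_comb M (Q * P) = 0) ->
  coef_comb M 'X_[mu] = 1 ->
  (forall J (h : hom J I) (x : 'cV[R J]_m), zero_locus p x ->
     rres R h c * \prod_v x v 0 ^+ mu v = 0) ->
  c = 0.
Proof.
move=> wp L0 L1 H.
have n0 : natural_on (B := yoneda I) (F := space R m)
    (fun J _ (x : 'cV[R J]_m) => zero_locus p x) (fun J _ _ => 0 : R J).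
  by move=> J K g b x _; rewrite rmorph0.
have [_ uniq] := line_KL wp n0.
have [||T Tp HT] := uniq [:: (c, 'X_[mu])] [::].
- move=> J h x zx; rewrite /rpoly_eval big_map big_seq1 /=.
  by have [_ _ _ ->] := int_eval_spec x; rewrite H.
- by move=> J h x zx; rewrite /rpoly_eval big_nil.
have L0' P : in_ideal p P -> coef_comb M P = 0.
  case=> q ->; elim/big_rec: _ => [|i Q _ IH].
    by rewrite /coef_comb big1 // => e _; rewrite mcoeff0 mulr0.
  by rewrite coef_combD IH addr0 L0 // mem_nth.
have : \sum_(e <- M) e.1%:~R * (rpoly_coef [:: (c, 'X_[mu])] e.2) = c.
  rewrite -[RHS]mulr1 -[in RHS](_ : 1%:~R = 1) // -L1 /coef_comb.
  rewrite rmorph_sum /= big_distrr /=; apply: eq_bigr => e _.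
  by rewrite /rpoly_coef big_seq1 /= rmorphM /= mulrCA.
move=> <-; transitivity (\sum_(t <- T) t.1 * (coef_comb M t.2)%:~R); last first.
  by rewrite big_seq big1 // => t tT; rewrite L0' ?mulr0 //; apply: Tp.
transitivity (\sum_(e <- M) e.1%:~R * rpoly_coef T e.2).
  by apply: eq_bigr => e _; rewrite -HT /rpoly_coef big_nil subr0.
rewrite /rpoly_coef; under eq_bigr do rewrite big_distrr /=.
rewrite exchange_big; apply: eq_bigr => t _; rewrite rmorph_sum big_distrr /=.
by apply: eq_bigr => e _; rewrite mulrCA rmorphM.
Qed.

End KockLawvere.

(** * The objects of infinitesimal simplices *)

Section Objects.
Variables (r k n : nat).

Let X i a : {mpoly int[k * n]} := 'X_(mxvec_index i a).

Definition simplex_row_eq (e : 'I_k * {ffun 'I_r.+1 -> 'I_n}) := \prod_j X e.1 (e.2 j).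
Definition simplex_diff_eq (e : 'I_k * 'I_k * {ffun 'I_r.+1 -> 'I_n}) :=
  \prod_j (X e.1.1 (e.2 j) - X e.1.2 (e.2 j)).

Definition simplex_eqs : seq {mpoly int[k * n]} :=
  [seq simplex_row_eq e | e <- enum {: 'I_k * {ffun 'I_r.+1 -> 'I_n}}] ++
  [seq simplex_diff_eq e | e <- enum {: 'I_k * 'I_k * {ffun 'I_r.+1 -> 'I_n}}].

Lemma simplex_eqsP P : P \in simplex_eqs ->
  (exists i al, P = simplex_row_eq (i, al)) \/
  (exists i i' al, P = simplex_diff_eq (i, i', al)).
Proof.
rewrite mem_cat => /orP[] /mapP [] => [[i al]|[[i i'] al]] _ ->.
  by left; exists i, al.
by right; exists i, i', al.
Qed.

Lemma simplex_row_eq_in e : simplex_row_eq e \in simplex_eqs.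
Proof. by rewrite mem_cat map_f // mem_enum. Qed.

Lemma simplex_diff_eq_in e : simplex_diff_eq e \in simplex_eqs.
Proof. by rewrite mem_cat [X in _ || X]map_f ?orbT // mem_enum. Qed.

Lemma weil_simplex_eqs : weil_presentation simplex_eqs.
Proof.
apply: (@weil_presentation_pow _ _ r.+1) => [P /simplex_eqsP|v].
  have X0 i a : (X i a)@_0%MM = 0 by rewrite mcoeffX mnm1_eq0.
  case=> [[i [al ->]]|[i [i' [al ->]]]];
    rewrite (rmorph_prod (mcoeff 0%MM)) big_ord_recl /=.
    by rewrite X0 mul0r.
  by rewrite mcoeffB !X0 subrr mul0r.
case/mxvec_indexP: v => i a.
rewrite (_ : _ ^+ _ = simplex_row_eq (i, [ffun => a])) ?simplex_row_eq_in //.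
rewrite /simplex_row_eq /=; under eq_bigr do rewrite ffunE.
by rewrite prodr_const card_ord.
Qed.

Lemma simplex_locus (A : comPzRingType) (Y : 'M[A]_(k, n)) :
  zero_locus simplex_eqs (mxvec Y)^T <-> simplex_mx r Y.
Proof.
have [hB _ _ _] := int_eval_spec (mxvec Y)^T.
have hX i a : int_eval (X i a) (mxvec Y)^T = Y i a.
  by rewrite int_evalXU mxE mxvecE.
have rowE e : int_eval (simplex_row_eq e) (mxvec Y)^T = \prod_j Y e.1 (e.2 j).
  by rewrite int_eval_prod; apply: eq_bigr => j _.
have diffE e : int_eval (simplex_diff_eq e) (mxvec Y)^T =
    \prod_j (Y e.1.1 (e.2 j) - Y e.1.2 (e.2 j)).
  by rewrite int_eval_prod; apply: eq_bigr => j _; rewrite hB !hX.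
split=> [H|[H1 H2] P /simplex_eqsP].
  split=> [i al|i i' al].
    have := H _ (simplex_row_eq_in (i, finfun al)); rewrite rowE => <-.
    by apply: eq_bigr => j _; rewrite ffunE.
  have := H _ (simplex_diff_eq_in (i, i', finfun al)); rewrite diffE => <-.
  by apply: eq_bigr => j _; rewrite !ffunE.
by case=> [[i [al ->]]|[i [i' [al ->]]]]; rewrite ?rowE ?diffE ?H1 ?H2.
Qed.

Lemma prod_mxvec (A : comPzRingType) (F : 'I_(k * n) -> A) :
  \prod_v F v = \prod_i \prod_a F (mxvec_index i a).
Proof.
rewrite pair_bigA /= (reindex _ (curry_mxvec_bij k n)) /=.
by apply: eq_bigr => -[i a] _.
Qed.

End Objects.

Section KLMatrix.
Variables (C : site) (R : number_line C).

(** Functions on the object of r-infinitesimal simplices at the origin of R^n,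
    given on displacement matrices. *)
Definition natural_mx r k n (I : C) (u : forall J, hom J I -> 'M[R J]_(k, n) -> R J) :=
  forall J K (h : hom J I) (g : hom K J) Y, simplex_mx r Y ->
    u K (comp h g) (map_mx (rres R g) Y) = rres R g (u J h Y).

Definition monomial_sum k n (I : C) (s : seq (R I * ('I_k -> 'I_n -> nat)))
    J (h : hom J I) (Y : 'M[R J]_(k, n)) : R J :=
  \sum_(t <- s) rres R h t.1 * \prod_i \prod_a Y i a ^+ t.2 i a.

Lemma kl_matrix r k n (I : C) (u : forall J, hom J I -> 'M[R J]_(k, n) -> R J) :
  natural_mx r u ->
  exists s, forall J (h : hom J I) Y, simplex_mx r Y -> u J h Y = monomial_sum s h Y.
Proof.
move=> nu.
pose u' J (h : yoneda I J) (x : space R (k * n) J) := u J h (vec_mx x^T).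
have [|s Hs] := @kl_exists _ R _ _ I u' (weil_simplex_eqs r k n).
  move=> J K g h x zx; rewrite /u' -nu; last by rewrite -simplex_locus vec_mxK trmxK.
  by congr u; apply/matrixP => i a; rewrite !mxE.
exists [seq (t.1, fun i a => t.2 (mxvec_index i a)) | t <- s] => J h Y sY.
have := Hs J h (mxvec Y)^T; rewrite simplex_locus => /(_ sY).
rewrite /u' trmxK mxvecK => ->; rewrite /monomial_sum big_map; apply: eq_bigr => t _.
rewrite prod_mxvec; congr (_ * _); apply: eq_bigr => i _; apply: eq_bigr => a _.
by rewrite mxE mxvecE.
Qed.

Lemma mcoeffMXE m (Q : {mpoly int[m]}) (l mu : 'X_{1..m}) :
  (Q * 'X_[l])@_mu = if (l <= mu)%MM then Q@_(mu - l)%MM else 0.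
Proof.
case: ifP => le; first by rewrite -{1}(submK le) addmC mcoeffMX.
apply/eqP; rewrite mcoeff_eq0 (perm_mem (msuppMX _ _)); apply/negP => /mapP [l' _ e].
by case/negP: (negbT le); rewrite e; apply/mnm_lepP => i; rewrite mnmDE leq_addr.
Qed.

(** On the n-fold power of the object of square-zero elements, the coefficient
    of the product of all variables is not affected by the equations. *)
Lemma square_zero_cancel n (I : C) (c : R I) :
  (forall J (h : hom J I) (s : 'I_n -> R J), (forall i, s i * s i = 0) ->
     rres R h c * \prod_i s i = 0) -> c = 0.
Proof.
move=> H; pose p : seq {mpoly int[n]} := [seq 'X_i ^+ 2 | i <- enum 'I_n].
pose mu : 'X_{1..n} := [multinom 1%N | i < n].
apply: (@kl_cancel _ R n p [:: (1, mu)] mu).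
- apply: (@weil_presentation_pow _ _ 2) => [P /mapP [i _ ->]|v]; last first.
    by apply/mapP; exists v; rewrite ?mem_enum.
  by rewrite rmorphXn /= mcoeffX mnm1_eq0 expr0n.
- move=> P Q /mapP [i _ ->]; rewrite /coef_comb big_seq1 mul1r mpolyXn mcoeffMXE.
  case: ifP => // /mnm_lepP /(_ i); by rewrite mulmnE mnm1E eqxx mnmE.
- by rewrite /coef_comb big_seq1 mul1r mcoeffX eqxx.
- move=> J h x zx; rewrite -(H J h (fun i => x i 0)).
    by congr (_ * _); apply: eq_bigr => i _; rewrite mnmE expr1.
  move=> i; have : 'X_i ^+ 2 \in p by apply/mapP; exists i; rewrite ?mem_enum.
  move=> /zx.
  by have [_ hM _ _] := int_eval_spec x; rewrite expr2 hM int_evalXU.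
Qed.

Section AltFunctional.
Variable n : nat.

Let perm_monomial (s : 'S_n) : 'X_{1..n * n} := (\sum_i U_(mxvec_index i (s i)))%MM.
Let M := [seq ((-1) ^+ odd_perm s : int, perm_monomial s) | s : 'S_n <- enum 'S_n].
Let X i a : {mpoly int[n * n]} := 'X_(mxvec_index i a).

Lemma eq_mxvec_index (i j : 'I_n) (a b : 'I_n) :
  (mxvec_index i a == mxvec_index j b) = (i == j) && (a == b).
Proof.
apply/eqP/andP => [e|[/eqP -> /eqP ->]] //.
have := congr1 (fun v => mxvec (\matrix_(i < n, a < n) (i, a)) 0 v) e.
by rewrite !mxvecE !mxE => -[-> ->].
Qed.

Lemma perm_monomialE (s : 'S_n) i a : perm_monomial s (mxvec_index i a) = (s i == a).
Proof.
rewrite mnm_sumE (bigD1 i) //= mnm1E eq_mxvec_index eqxx /= big1 ?addn0 // => j ne.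
by rewrite mnm1E eq_mxvec_index (negPf ne).
Qed.

Lemma coef_combE P : coef_comb M P = \sum_(s : 'S_n) (-1) ^+ s * P@_(perm_monomial s).
Proof. by rewrite /coef_comb big_map big_enum. Qed.

Lemma pair_le i j a b (s : 'S_n) : i != j ->
  (U_(mxvec_index i a) + U_(mxvec_index j b) <= perm_monomial s)%MM = (s i == a) && (s j == b).
Proof.
move=> ne; apply/mnm_lepP/andP => [H|[/eqP ea /eqP eb] v].
  have := H (mxvec_index i a); have := H (mxvec_index j b).
  rewrite !mnmDE !mnm1E !eq_mxvec_index !eqxx !perm_monomialE /=.
  by case: (s i == a); case: (s j == b) => //; rewrite ?addn1 // addnC addn1.
case/mxvec_indexP: v => k c; rewrite mnmDE !mnm1E !eq_mxvec_index perm_monomialE -ea -eb.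
have [<-|nk] := eqVneq i k; first by rewrite eq_sym in ne; rewrite (negPf ne) addn0.
by have [<-|] := eqVneq j k.
Qed.

(** The two terms of the symmetric relation contribute opposite signs: the
    coefficient of the first at s is that of the second at s composed with the
    transposition of i and j. *)
Lemma coef_comb_swap i j a b Q : i != j ->
  coef_comb M (Q * (X i a * X j b + X j a * X i b)) = 0.
Proof.
move=> ne; rewrite mulrDr coef_combD !coef_combE.
rewrite [X in X + _](reindex_inj (mulgI (tperm i j))) /= -big_split big1 // => s _ /=.
rewrite odd_permM odd_tperm ne signr_addb /= expr1 mulN1r mulNr.
apply/eqP; rewrite addrC subr_eq0; apply/eqP; congr (_ * _).
have ne' : j != i by rewrite eq_sym.
rewrite -!mpolyXD !mcoeffMXE (pair_le _ _ _ ne) (pair_le _ _ _ ne') !permM tpermL tpermR.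
case: ifP => // /andP[/eqP sj /eqP si]; congr (Q@_ _); apply/mnmP => v.
case/mxvec_indexP: v => k c; rewrite !mnmBE !mnmDE !mnm1E !eq_mxvec_index !perm_monomialE permM.
have [<-|nk] := eqVneq i k.
  by rewrite tpermL sj si (negPf ne') /= add0n addn0 !subnn.
have [<-|nk'] := eqVneq j k; last by rewrite tpermD.
by rewrite tpermR sj si /= add0n addn0 !subnn.
Qed.

Lemma coef_comb_row i a b Q : coef_comb M (Q * (X i a * X i b)) = 0.
Proof.
rewrite coef_combE big1 // => s _; rewrite -mpolyXD mcoeffMXE.
case: ifP; last by rewrite mulr0.
move=> /mnm_lepP H; have := H (mxvec_index i a); have := H (mxvec_index i b).
rewrite !mnmDE !mnm1E !eq_mxvec_index !eqxx !perm_monomialE /= [b == a]eq_sym.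
have [<-|ne] := eqVneq a b; first by case: (s i == a).
case: eqP => // -> _; case: eqP => // e; by rewrite e eqxx in ne.
Qed.

(** The signed sum of the coefficients of the monomials of all permutations
    kills the ideal of the 1-infinitesimal simplices, so the product of the
    diagonal entries is cancellable there. *)
Lemma simplex1_cancel (I : C) (c : R I) :
  (forall J (h : hom J I) (Y : 'M[R J]_n), simplex_mx 1 Y ->
     rres R h c * \prod_i Y i i = 0) -> c = 0.
Proof.
move=> H; apply: (@kl_cancel _ R _ (simplex_eqs 1 n n) M (perm_monomial 1%g)).
- exact: weil_simplex_eqs.
- move=> P Q /simplex_eqsP [[i [al ->]]|[i [j [al ->]]]].
    by rewrite /simplex_row_eq !big_ord_recl big_ord0 mulr1; apply: coef_comb_row.
  rewrite /simplex_diff_eq !big_ord_recl big_ord0 mulr1 /=.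
  have [->|ne] := eqVneq i j.
    by rewrite !subrr !mulr0 coef_combE big1 // => s _; rewrite mcoeff0 mulr0.
  move: (al _) (al _) => a b.
  transitivity (coef_comb M (
    Q * (X i a * X i b) + (Q * (X j a * X j b) + (- Q) * (X i a * X j b + X j a * X i b)))).
    by congr coef_comb; rewrite /X; ring.
  by rewrite !coef_combD !coef_comb_row coef_comb_swap // !addr0.
- rewrite coef_combE (bigD1 1%g) //= odd_perm1 mul1r mcoeffX eqxx big1 ?addr0 // => s ne.
  rewrite mcoeffX; case: eqP => [e|_]; last by rewrite mulr0.
  case/eqP: ne; apply/permP => i; rewrite perm1; apply/eqP.
  by have := congr1 (fun m : 'X_{1..n * n} => m (mxvec_index i i)) e; rewrite !perm_monomialE perm1 eqxx; case: eqP.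
- move=> J h x zx; have sx : simplex_mx 1 (vec_mx x^T) by rewrite -simplex_locus vec_mxK trmxK.
  rewrite -(H J h _ sx) prod_mxvec; congr (_ * _); apply: eq_bigr => i _.
  rewrite (bigD1 i) //= perm_monomialE perm1 eqxx expr1 big1 ?mulr1 ?mxE // => a ne.
  by rewrite perm_monomialE perm1 eq_sym (negPf ne).
Qed.

End AltFunctional.

End KLMatrix.

(** * Functions on infinitesimal simplices *)

Lemma simplex_mx_map (A B : comPzRingType) (f : {rmorphism A -> B}) r k n (Y : 'M[A]_(k, n)) :
  simplex_mx r Y -> simplex_mx r (map_mx f Y).
Proof.
case=> H1 H2; split=> [i al|i i' al].
  by rewrite -(rmorph0 f) -(H1 i al) rmorph_prod; apply: eq_bigr => j _; rewrite mxE.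
rewrite -(rmorph0 f) -(H2 i i' al) rmorph_prod; apply: eq_bigr => j _.
by rewrite !mxE rmorphB.
Qed.

Lemma simplex_mx0 (A : comPzRingType) r k n : simplex_mx r (0 : 'M[A]_(k, n)).
Proof.
by split=> [i al|i i' al]; rewrite big_ord_recl !mxE ?subrr mul0r.
Qed.

Lemma ord_monomial (A : comPzRingType) k n (Y : 'M[A]_(k, n)) (mu : 'I_k -> 'I_n -> nat) :
  order_ge (entries Y) (\sum_i \sum_a mu i a) (\prod_i \prod_a Y i a ^+ mu i a).
Proof.
apply: ord_prod => i; apply: ord_prod => a.
elim: (mu i a) => [|d IH]; first exact: ord_any.
by rewrite exprS -add1n; apply: ordM => //; apply: ord_entry.
Qed.

Lemma mul_square_zero_prod (A : comPzRingType) (T : finType) (Q : pred T) (s : A) (x y : T -> A) :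
  s * s = 0 -> s * \prod_(k | Q k) (x k + s * y k) = s * \prod_(k | Q k) x k.
Proof.
move=> s0; elim/big_rec2: _ => // k z w _ IH.
rewrite mulrCA IH [RHS]mulrCA mulrDl -mulrA [y k * _]mulrCA !mulrA s0 !mul0r addr0 //.
Qed.

Lemma mul3_square_zero (A : comPzRingType) (s t : A) (x y : 'I_3 -> A) :
  s * s = 0 -> t * t = 0 -> \prod_j (s * x j + t * y j) = 0.
Proof.
move=> s0 t0; rewrite !big_ord_recl big_ord0 mulr1.
move: (x _) (y _) (x _) (y _) (x _) (y _) => x0 y0 x1 y1 x2 y2.
transitivity (s * s * (x0 * x1 * (s * x2 + t * y2) + t * x0 * y1 * x2 + t * y0 * x1 * x2)
  + t * t * (y0 * y1 * (s * x2 + t * y2) + s * x0 * y1 * y2 + s * y0 * x1 * y2)); last first.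
  by rewrite s0 t0 !mul0r addr0.
by ring.
Qed.

Lemma prod_eq_ffun (A : comPzRingType) (T T' : finType) (f g : {ffun T -> T'}) :
  \prod_k (f k == g k)%:R = (f == g)%:R :> A.
Proof.
have [->|ne] := eqVneq f g; first by rewrite big1 // => k _; rewrite eqxx.
have [k nk] : exists k, f k != g k.
  apply/existsP; apply: contraT; rewrite negb_exists => /forallP H.
  by case/eqP: ne; apply/ffunP => k; apply/eqP; have := H k; rewrite negbK.
by rewrite (bigD1 k) //= (negPf nk) mul0r.
Qed.

Section Structure.
Variables (C : site) (R : number_line C).

Lemma add_self_eq0 (I : C) (z : R I) : z + z = 0 -> z = 0.
Proof.
by move=> e; rewrite -[z]mul1r -(invnE R I (ltn0Sn 1)) mulrAC mulr_natl mulr2n e mul0r.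
Qed.

Lemma natr_mul_eq0 (I : C) N (z : R I) : (0 < N)%N -> N%:R * z = 0 -> z = 0.
Proof.
by move=> N0 e; rewrite -[z]mul1r -(invnE R I N0) mulrAC e mul0r.
Qed.

(** Hadamard's lemma: a polynomial differs from its constant term by an element
    of the ideal of the variables. *)
Lemma hadamard r k n (I : C) (u : forall J, hom J I -> 'M[R J]_(k, n) -> R J) :
  natural_mx r u -> forall J (h : hom J I) Y, simplex_mx r Y ->
  order_ge (entries Y) 1 (u J h Y - u J h 0).
Proof.
move=> /kl_matrix [s Hs] J h Y sY; rewrite !Hs //; last exact: simplex_mx0.
rewrite /monomial_sum -sumrB; apply: ord_sum => t _; rewrite -mulrBr; apply: ord_mul.
have [/existsP [i /existsP [a ia]]|] := boolP [exists i, exists a, (0 < t.2 i a)%N].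
  rewrite [X in _ - X](bigD1 i) //= (bigD1 a) //= mxE expr0n -leqn0 leqNgt ia !mul0r subr0.
  apply: ord_leq (ord_monomial Y t.2).
  by rewrite (bigD1 i) //= (bigD1 a) //= -addnA; apply: leq_trans ia _; rewrite leq_addr.
rewrite negb_exists => /forallP H.
rewrite [X in X - _](_ : _ = 1) ?[X in _ - X](_ : _ = 1).
- rewrite subrr; exact: ord_zero.
- apply: big1 => i _; apply: big1 => a _; have := H i; rewrite negb_exists => /forallP /(_ a).
  by rewrite lt0n negbK => /eqP ->.
- apply: big1 => i _; apply: big1 => a _; have := H i; rewrite negb_exists => /forallP /(_ a).
  by rewrite lt0n negbK => /eqP ->.
Qed.

(** Monomials avoiding row i are unchanged when that row is set to zero, while
    the others become zero; so the former add up to the value of u at a matrix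
    with a zero row, that is to zero, and can be dropped. *)
Lemma all_rows_monomials r k n (I : C) (u : forall J, hom J I -> 'M[R J]_(k, n) -> R J) :
  natural_mx r u ->
  (forall J (h : hom J I) Y, simplex_mx r Y ->
     forall i, (forall a, Y i a = 0) -> u J h Y = 0) ->
  exists2 s : seq (R I * ('I_k -> 'I_n -> nat)),
    forall J (h : hom J I) Y, simplex_mx r Y -> u J h Y = monomial_sum s h Y &
    all (fun t => [forall i, [exists a, (0 < t.2 i a)%N]]) s.
Proof.
move=> nu u0.
have : forall L : seq 'I_k, exists2 s : seq (R I * ('I_k -> 'I_n -> nat)),
    forall J (h : hom J I) Y, simplex_mx r Y -> u J h Y = monomial_sum s h Y &
    all (fun t => all (fun i => [exists a, (0 < t.2 i a)%N]) L) s.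
  elim=> [|i L [s Hs sL]].
    have [s Hs] := kl_matrix nu; exists s => //=; exact: all_predT.
  exists [seq t <- s | [exists a, (0 < t.2 i a)%N]]; last first.
    by rewrite all_filter; apply: sub_all sL => t /= ->; rewrite andbT; apply/implyP.
  move=> J h Y sY.
  (* Y0 is Y with row i erased; it is still a simplex, with vertex i moved to the
     first vertex. *)
  pose Y0 : 'M[R J]_(k, n) := \matrix_(i', a) if i' == i then 0 else Y i' a.
  have sY0 : simplex_mx r Y0.
    case: sY => H1 H2.
    have P : \prod_(j < r.+1) (0 - 0 : R J) = 0.
      by rewrite big_ord_recl subrr mul0r.
    have PN i' (al : 'I_r.+1 -> 'I_n) : \prod_j (0 - Y i' (al j)) = 0.
      under eq_bigr do rewrite sub0r -mulN1r.
      by rewrite big_split /= H1 mulr0.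
    split=> [i1 al|i1 i2 al].
      under eq_bigr do rewrite mxE; case: (i1 == i); last exact: H1.
      by rewrite big_ord_recl mul0r.
    under eq_bigr do rewrite !mxE.
    case: (i1 == i); case: (i2 == i); rewrite ?P ?PN //.
    by under eq_bigr do rewrite subr0; apply: H1.
  have e0 : u J h Y0 = 0 by apply: (u0 _ _ _ sY0 i) => a; rewrite mxE eqxx.
  rewrite -[u J h Y]subr0 -e0 !Hs // /monomial_sum -sumrB big_filter.
  rewrite (bigID (fun t => [exists a, (0 < t.2 i a)%N])) /= [X in _ + X]big1 ?addr0.
    apply: eq_bigr => t /existsP [a ia].
    rewrite [X in _ - _ * X](bigD1 i) //= (bigD1 a) //= mxE eqxx expr0n -leqn0 leqNgt ia.
    by rewrite !mul0r mulr0 subr0.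
  move=> t; rewrite negb_exists => /forallP H.
  apply/eqP; rewrite subr_eq0; apply/eqP; congr (_ * _).
  apply: eq_bigr => i' _; apply: eq_bigr => a _; rewrite mxE.
  case: eqP => // ->; have := H a; rewrite lt0n negbK => /eqP ->.
  by rewrite !expr0.
move=> /(_ (enum 'I_k)) [s Hs sL]; exists s => //.
apply: sub_all sL => t /allP H; apply/forallP => i; apply: H; exact: mem_enum.
Qed.

(** A monomial meeting every row either takes exactly one entry in each row or
    has degree at least n + 1. *)
Lemma leading_monomial (A : comPzRingType) n (Y : 'M[A]_n) (mu : 'I_n -> 'I_n -> nat) :
  (forall i, exists a, (0 < mu i a)%N) ->
  order_ge (entries Y) n.+1 (\prod_i \prod_a Y i a ^+ mu i a -
    \sum_(al : {ffun 'I_n -> 'I_n} | [forall i, [forall a, mu i a == (a == al i)]])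
      \prod_i Y i (al i)).
Proof.
move=> /fin_all_exists [al0 Hal0]; pose al := finfun al0.
have Hal i : (0 < mu i (al i))%N by rewrite ffunE.
have uniq_al (be : {ffun 'I_n -> 'I_n}) :
    [forall i, [forall a, mu i a == (a == be i)]] -> be = al.
  move=> /forallP H; apply/ffunP => i; have /forallP /(_ (al i)) := H i.
  by move=> /eqP e; have := Hal i; rewrite e; case: eqP.
have [cal|] := boolP [forall i, [forall a, mu i a == (a == al i)]].
  rewrite (big_pred1 al) => [|be]; last first.
    by apply/idP/eqP => [/uniq_al //|->].
  rewrite [X in X - _](_ : _ = \prod_i Y i (al i)) ?subrr; first exact: ord_zero.
  apply: eq_bigr => i _; have /forallP := forallP cal i => H.
  rewrite (bigD1 (al i)) //= (eqP (H _)) eqxx expr1 big1 ?mulr1 // => a ne.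
  by rewrite (eqP (H a)) (negPf ne).
move=> ncal; rewrite [X in _ - X]big_pred0 ?subr0 => [|be]; last first.
  by apply/negP => cbe; case/negP: ncal; rewrite -(uniq_al _ cbe).
apply: ord_leq (ord_monomial Y mu).
move: ncal; rewrite negb_forall => /existsP [i0]; rewrite negb_forall => /existsP [a0 ne].
have row i : (1 + (i == i0) <= \sum_a mu i a)%N.
  rewrite (bigD1 (al i)) //=; have := Hal i.
  case: (eqVneq i i0) => [->|_] lt; last by rewrite addn0 (leq_trans lt) ?leq_addr.
  move: ne; have [->|na] := eqVneq a0 (al i0).
    case: (mu i0 (al i0)) lt => [|[|d]] //.
  rewrite (bigD1 a0) //= addnA -lt0n => lt'.
  by rewrite (leq_trans _ (leq_addr _ _)) // leq_add.
have -> : (n.+1 = \sum_i (1 + (i == i0)))%N.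
  rewrite big_split /= sum1_card card_ord (bigD1 i0) //= eqxx big1 ?addn0 ?addn1 //.
  by move=> i /negPf ->.
exact: leq_sum.
Qed.

Lemma leading_form r n (I : C) (u : forall J, hom J I -> 'M[R J]_n -> R J) :
  natural_mx r u ->
  (forall J (h : hom J I) Y, simplex_mx r Y ->
     forall i, (forall a, Y i a = 0) -> u J h Y = 0) ->
  exists F : {ffun 'I_n -> 'I_n} -> R I, forall J (h : hom J I) Y, simplex_mx r Y ->
    order_ge (entries Y) n.+1
      (u J h Y - \sum_al rres R h (F al) * \prod_i Y i (al i)).
Proof.
move=> nu u0; have [s Hs sall] := all_rows_monomials nu u0.
(* The coefficient at al collects the monomials that are the product of the
   entries Y i (al i). *)
pose cond (t : R I * ('I_n -> 'I_n -> nat)) (al : {ffun 'I_n -> 'I_n}) :=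
  [forall i, [forall a, t.2 i a == (a == al i)]].
exists (fun al => \sum_(t <- s) if cond t al then t.1 else 0) => J h Y sY.
under eq_bigr do rewrite rmorph_sum big_distrl /=.
rewrite exchange_big /= Hs // /monomial_sum -sumrB -(all_filterP sall) big_filter.
apply: ord_sum => t /forallP tall.
rewrite (_ : \sum_al _ = rres R h t.1 *
  \sum_(al | cond t al) \prod_i Y i (al i)); last first.
  rewrite big_distrr [RHS]big_mkcond /=; apply: eq_bigr => al _.
  by case: ifP => // _; rewrite rmorph0 mul0r.
rewrite -mulrBr; apply: ord_mul; apply: leading_monomial => i.
by have /existsP := tall i.
Qed.

(** On 1-infinitesimal simplices nothing of degree n + 1 survives, and every
    product of one entry per row is, up to sign, the product of the diagonal
    entries. *)
Lemma form_eq_diag n (I : C) (u : forall J, hom J I -> 'M[R J]_n -> R J) :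
  natural_mx 1 u ->
  (forall J (h : hom J I) Y, simplex_mx 1 Y ->
     forall i, (forall a, Y i a = 0) -> u J h Y = 0) ->
  exists c : R I, forall J (h : hom J I) Y, simplex_mx 1 Y ->
    u J h Y = rres R h c * \prod_i Y i i.
Proof.
move=> nu u0; have [F HF] := leading_form nu u0.
exists (\sum_(s : 'S_n) F [ffun k => s k] * (-1) ^+ s) => J h Y sY.
have le1 : ((n * 1).+1 <= n.+1)%N by rewrite muln1.
have /eqP := ord_nil sY.1 (ord_leq le1 (HF J h Y sY)); rewrite subr_eq0 => /eqP ->.
have altY := simplex1_alternating sY.
rewrite sum_ffun_perm => [|al /(alternating_ninj (@add_self_eq0 J) altY) ->]; last by rewrite mulr0.
rewrite rmorph_sum big_distrl /=; apply: eq_bigr => s _.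
rewrite (alternating_perm s altY) rmorphM rmorph_sign mulrA; congr (_ * _).
by apply: eq_bigr => i _; rewrite ffunE.
Qed.


(** A 2-infinitesimal simplex whose vertices have moved away from a common
    centre along independent first-order segments: the first vertex by
    - s_j e_(al j), vertex k by s_k e_(al k), with vertex j then put on top of
    vertex i. *)
Definition degenerate_mx (A : comPzRingType) n (s : 'I_n -> A) (i j : 'I_n)
    (al : 'I_n -> 'I_n) : 'M[A]_n :=
  \matrix_(k, a) (s (if k == j then i else k) * (al (if k == j then i else k) == a)%:R
                        + s j * (al j == a)%:R).

Lemma simplex_degenerate (A : comPzRingType) n (s : 'I_n -> A) (i j : 'I_n)
    (al : 'I_n -> 'I_n) :
  (forall k, s k * s k = 0) -> simplex_mx 2 (degenerate_mx s i j al).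
Proof.
move=> s0; split=> [k be|k l be].
  by under eq_bigr do rewrite mxE; apply: mul3_square_zero.
under eq_bigr do rewrite !mxE opprD addrACA subrr addr0 -mulrN.
exact: mul3_square_zero.
Qed.

Lemma ord_degenerate (A : comPzRingType) n (s : 'I_n -> A) (i j : 'I_n)
    (al : 'I_n -> 'I_n) z :
  (forall k, s k * s k = 0) -> order_ge (entries (degenerate_mx s i j al)) n.+1 z -> z = 0.
Proof.
move=> s0 Hz; pose S : 'M[A]_(n, 1) := \matrix_(k, _) s k.
have nS : row_nil 1 S by move=> k be; rewrite 2!big_ord_recl big_ord0 mulr1 !mxE s0.
have le1 : ((n * 1).+1 <= n.+1)%N by rewrite muln1.
apply: (ord_nil nS); apply: (ord_leq le1); apply: ord_trans Hz => e [k [a ->]].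
have oS l : order_ge (entries S) 1 (s l) by have := ord_entry S l 0; rewrite mxE.
by rewrite mxE; apply: ord_add; rewrite mulrC; apply: ord_mul.
Qed.

(** In degree n, each s_k with k different from i and j can only come from row
    k, while s_i and s_j come from rows i and j in either order. *)
Lemma prod_degenerate (A : comPzRingType) n (s : 'I_n -> A) (i j : 'I_n)
    (al be : {ffun 'I_n -> 'I_n}) :
  i != j -> (forall k, s k * s k = 0) ->
  \prod_k degenerate_mx s i j al k (be k) =
  ((al == be)%:R + ([ffun k => al (tperm i j k)] == be)%:R) * \prod_k s k.
Proof.
move=> ne s0; have ne' : j != i by rewrite eq_sym.
pose Q := [pred k : 'I_n | (k != i) && (k != j)].
have split2 (F : 'I_n -> A) : \prod_k F k = F i * (F j * \prod_(k | Q k) F k).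
  by rewrite (bigD1 i) //= (bigD1 j).
rewrite -!prod_eq_ffun !split2 !ffunE !mxE eqxx (negPf ne) tpermL tpermR.
set PQ := \prod_(k | Q k) degenerate_mx _ _ _ _ _ _.
have -> : PQ = \prod_(k | Q k) (s k * (al k == be k)%:R + s j * (al j == be k)%:R).
  by apply: eq_bigr => k /andP[_ nj]; rewrite mxE (negPf nj).
have -> : \prod_(k | Q k) ([ffun k => al (tperm i j k)] k == be k)%:R
    = \prod_(k | Q k) (al k == be k)%:R :> A.
  by apply: eq_bigr => k /andP[ni nj]; rewrite ffunE tpermD // eq_sym.
have H := @mul_square_zero_prod A 'I_n Q (s j) (fun k => s k * (al k == be k)%:R)
  (fun k => (al j == be k)%:R) (s0 j).
rewrite big_split /= in H.
move: H (s0 i) (s0 j); move: (\prod_(k | Q k) s k) (\prod_(k | Q k) _%:R) (\prod_(k | Q k) _).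
move: (s i) (s j) (_%:R) (_%:R) (_%:R) (_%:R) => si sj a b c d P1 P2 P3 H si0 sj0.
transitivity (si * si * (d * b * P3) + sj * sj * (c * a * P3) + si * (d * a + c * b) * (sj * P3)).
  by ring.
by rewrite si0 sj0 H; ring.
Qed.

(** Vanishing on [degenerate_mx] says that the coefficient of al and that of al
    with i and j exchanged are opposite, so the n-linear part is a multiple of
    the determinant. *)
Lemma extended_form_leading n (I : C) (u : forall J, hom J I -> 'M[R J]_n -> R J) :
  natural_mx 2 u ->
  (forall J (h : hom J I) Y, simplex_mx 2 Y ->
     forall i, (forall a, Y i a = 0) -> u J h Y = 0) ->
  (forall J (h : hom J I) Y, simplex_mx 2 Y ->
     forall i j, i != j -> (forall a, Y i a = Y j a) -> u J h Y = 0) ->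
  exists c : R I, forall J (h : hom J I) Y, simplex_mx 2 Y ->
    order_ge (entries Y) n.+1 (u J h Y - rres R h c * \det Y).
Proof.
move=> nu u0 ueq; have [F HF] := leading_form nu u0.
have altF : alternating F.
  move=> i j ne al; apply/eqP; rewrite -addr_eq0; apply/eqP.
  apply: (@square_zero_cancel _ R n) => J h s s0.
  have sY := simplex_degenerate i j al s0.
  have uY : u J h (degenerate_mx s i j al) = 0.
    by apply: (ueq _ _ _ sY i j ne) => a; rewrite !mxE eqxx (negPf ne).
  have := HF J h _ sY; rewrite uY sub0r => /(ord_degenerate s0)/eqP.
  rewrite oppr_eq0 => /eqP <-.
  transitivity (\sum_be (rres R h (F be) * (al == be)%:R * \prod_k s k +
      rres R h (F be) * ([ffun k => al (tperm i j k)] == be)%:R * \prod_k s k)); last first.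
    by apply: eq_bigr => be _; rewrite prod_degenerate // mulrA mulrDr mulrDl.
  rewrite big_split /= -!big_distrl /= rmorphD mulrDl addrC; congr (_ * _ + _ * _).
    rewrite (bigD1 [ffun k => al (tperm i j k)]) //= eqxx mulr1 big1 ?addr0 // => be nb.
    by rewrite eq_sym (negPf nb) mulr0.
  rewrite (bigD1 al) //= eqxx mulr1 big1 ?addr0 // => be nb.
  by rewrite eq_sym (negPf nb) mulr0.
exists (F [ffun k => k]) => J h Y sY; have := HF J h Y sY.
rewrite (@alternating_det _ _ (@add_self_eq0 J) (fun al => rres R h (F al))) //.
by move=> i j ne al; rewrite altF // rmorphN.
Qed.

(** u = c det + e with e of order n + 1 gives u^2 = (c det)^2 + terms of order
    2 n + 1, which vanish. *)
Lemma extended_form_sqr n (I : C) (u : forall J, hom J I -> 'M[R J]_n -> R J) c :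
  (forall J (h : hom J I) Y, simplex_mx 2 Y ->
    order_ge (entries Y) n.+1 (u J h Y - rres R h c * \det Y)) ->
  forall J (h : hom J I) Y, simplex_mx 2 Y -> u J h Y ^+ 2 = (rres R h c * \det Y) ^+ 2.
Proof.
move=> H J h Y sY; have := H J h Y sY; set D := rres R h c * \det Y.
have oD : order_ge (entries Y) n D by apply: ord_mul; apply: ord_det.
move=> oz; apply/eqP; rewrite -subr_eq0 subr_sqr; apply/eqP.
apply: (ord_nil sY.1); rewrite muln2 -addnn -addSn; apply: ordM => //.
rewrite (_ : u J h Y + D = (u J h Y - D) + (D + D)); last by ring.
by apply: ord_add; [apply: ord_leq oz | apply: ord_add].
Qed.

Lemma simplex_mx12 (A : comPzRingType) k n (Y : 'M[A]_(k, n)) : simplex_mx 1 Y -> simplex_mx 2 Y.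
Proof.
by case=> H1 H2; split=> [i al|i i' al]; rewrite big_ord_recr /= ?H1 ?H2 mul0r.
Qed.

Lemma det_cancel n (I : C) (c : R I) :
  (forall J (h : hom J I) (Y : 'M[R J]_n), simplex_mx 1 Y -> rres R h c * \det Y = 0) ->
  c = 0.
Proof.
move=> H; apply: (@simplex1_cancel _ R n) => J h Y sY.
apply: (natr_mul_eq0 (fact_gt0 n)); rewrite mulrCA -simplex1_det //; exact: H.
Qed.

Lemma extended_form_leading_unique n (I : C) (u : forall J, hom J I -> 'M[R J]_n -> R J) c c' :
  (forall J (h : hom J I) Y, simplex_mx 2 Y ->
    order_ge (entries Y) n.+1 (u J h Y - rres R h c * \det Y)) ->
  (forall J (h : hom J I) Y, simplex_mx 1 Y -> u J h Y = rres R h c' * \det Y) -> c = c'.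
Proof.
move=> Hc Hc'; apply/eqP; rewrite eq_sym -subr_eq0; apply/eqP.
apply: (@det_cancel n) => J h Y sY; rewrite rmorphB mulrBl -Hc' //.
have le1 : ((n * 1).+1 <= n.+1)%N by rewrite muln1.
exact: ord_nil sY.1 (ord_leq le1 (Hc J h Y (simplex_mx12 sY))).
Qed.

Lemma simplex_mxD (A : comPzRingType) k n (Y Z : 'M[A]_(k, n)) :
  simplex_mx 1 Y -> simplex_mx 1 Z -> simplex_mx 2 (Y + Z).
Proof.
have key (y z : 'I_n -> A) (al : 'I_3 -> 'I_n) :
    (forall be : 'I_2 -> 'I_n, \prod_j y (be j) = 0) ->
    (forall be : 'I_2 -> 'I_n, \prod_j z (be j) = 0) ->
    \prod_j (y (al j) + z (al j)) = 0.
  move=> Hy Hz.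
  have y0 a b : y a * y b = 0.
    by have := Hy (fun k => if k == ord0 then a else b); rewrite 2!big_ord_recl big_ord0 /= mulr1.
  have z0 a b : z a * z b = 0.
    by have := Hz (fun k => if k == ord0 then a else b); rewrite 2!big_ord_recl big_ord0 /= mulr1.
  rewrite !big_ord_recl big_ord0 mulr1; move: (al _) (al _) (al _) => a b c.
  transitivity (y a * y b * (y c + z c) + y a * y c * z b + y b * y c * z a
     + z a * z b * (y c + z c) + z a * z c * y b + z b * z c * y a).
    by ring.
  by rewrite !y0 !z0 !mul0r !addr0.
case=> Y1 Y2 [Z1 Z2]; split=> [i al|i i' al].
  by under eq_bigr do rewrite mxE; apply: key => be; [apply: Y1|apply: Z1].
under eq_bigr do rewrite !mxE opprD addrACA.
by apply: (key (fun a => Y i a - Y i' a) (fun a => Z i a - Z i' a)) => be; [apply: Y2|apply: Z2].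
Qed.

(** Two successive cancellations on 1-infinitesimal simplices, applied to the
    sum of two such simplices, suffice by [det_sqr_sum]. *)
Lemma det_sqr_cancel n (I : C) (c : R I) :
  (forall J (h : hom J I) (Y : 'M[R J]_n), simplex_mx 2 Y ->
     rres R h c * \det Y ^+ 2 = 0) -> c = 0.
Proof.
move=> H; apply: (@simplex1_cancel _ R n) => J h Y sY.
apply: (@simplex1_cancel _ R n) => K g Z sZ.
have sY' := simplex_mx_map (rres R g) sY.
(* N is invertible in R, being a positive integer. *)
have [N N0 e] := det_sqr_sum (@add_self_eq0 K) sY' sZ.
apply: (natr_mul_eq0 N0); have := H K (comp h g) _ (simplex_mxD sY' sZ).
rewrite e rres_comp => <-; rewrite rmorphM rmorph_prod.
rewrite (eq_bigr (fun i => map_mx (rres R g) Y i i)) => [|i _]; last by rewrite mxE.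
by rewrite -mulrA mulrCA.
Qed.

End Structure.

(** * Local properties *)

Section Sheaf.
Variables (C : site).

Lemma locally_everywhere (I : C) (Q : arrows I) : (forall J f, Q J f) -> locally Q.
Proof. by move=> H; exists (fun _ _ => True) => //; apply: cover_max. Qed.

Lemma locally_sub (I : C) (Q Q' : arrows I) :
  (forall J f, Q J f -> Q' J f) -> locally Q -> locally Q'.
Proof. by move=> H [S cS HS]; exists S => // J f /HS /H. Qed.

Lemma locally_pullback (I J : C) (f : hom J I) (Q : arrows I) :
  locally Q -> locally (fun K (g : hom K J) => Q K (comp f g)).
Proof.
by case=> S cS HS; exists (pullback f S); [apply: cover_pullback|move=> K g; apply: HS].
Qed.

Variable R : number_line C.

Lemma line_separated (I : C) (x y : R I) :
  locally (fun J (f : hom J I) => rres R f x = rres R f y) -> x = y.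
Proof.
case=> S cS HS.
have [|z [_ uz]] := @line_sheaf _ R I S cS (fun J f _ => rres R f x).
  by move=> J K f g Sf Sfg /=; rewrite rres_comp.
by rewrite -(uz x) ?(uz y) // => J f /HS.
Qed.

(** Unique existence is a local property: local witnesses agree on overlaps by
    uniqueness and glue since the line is a sheaf. *)
Lemma line_glue (I : C) (Phi : forall J, hom J I -> R J -> Prop) :
  (forall J K (h : hom J I) (g : hom K J) v, Phi J h v -> Phi K (comp h g) (rres R g v)) ->
  (forall J h v v', Phi J h v -> Phi J h v' -> v = v') ->
  locally (fun J h => exists v, Phi J h v) ->
  (forall v, locally (fun J h => Phi J h (rres R h v)) -> Phi I (idm I) v) ->
  exists v, Phi I (idm I) v.
Proof.
move=> stab uniq [S cS HS] loc.
pose s J (f : hom J I) (Sf : S J f) : R J :=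
  proj1_sig (constructive_indefinite_description _ (HS J f Sf)).
have Ps J f Sf : Phi J f (s J f Sf).
  by rewrite /s; case: constructive_indefinite_description.
have [|v [Hv _]] := @line_sheaf _ R I S cS s.
  by move=> J K f g Sf Sfg; apply: (uniq K (comp f g)); [apply: stab|].
exists v; apply: loc; exists S => // J f Sf.
by have /= -> := Hv J f Sf.
Qed.

End Sheaf.

(** * Neighbours and charts *)

Section VNeighbour.
Variable A : comPzRingType.

Lemma multilinear_expand n k (phi : {ffun 'I_k -> 'cV[A]_n} -> A)
    (u : {ffun 'I_k -> 'cV[A]_n}) (i : 'I_k) (z : 'cV[A]_n) :
  multilinear phi ->
  phi [ffun j => if j == i then z else u j] =
  \sum_a z a 0 * phi [ffun j => if j == i then delta_mx a 0 else u j].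
Proof.
move=> ml; pose f v := phi [ffun j => if j == i then v else u j].
have fD c v w : f (c *: v + w) = c * f v + f w by apply: ml.
have f0 : f 0 = 0.
  have := fD 1 0 0; rewrite scaler0 addr0 mul1r => /eqP.
  by rewrite eq_sym -subr_eq0 addrK => /eqP.
have fS (L : seq 'I_n) : f (\sum_(a <- L) z a 0 *: delta_mx a 0) =
    \sum_(a <- L) z a 0 * f (delta_mx a 0).
  by elim: L => [|a L IH]; rewrite ?big_nil // !big_cons fD IH.
rewrite -/(f z) -fS; congr f; apply/matrixP => a b; rewrite summxE (bigD1 a) //= !mxE.
rewrite !ord1 !eqxx mulr1 big1 ?addr0 // => c ne.
by rewrite !mxE eq_sym (negPf ne) mulr0.
Qed.

(** Infinitesimal neighbours in coordinates.  In one direction the products of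
    coordinates are multilinear; in the other, phi is expanded on basis vectors
    one argument at a time, the scalar c collecting the coordinates already
    extracted. *)
Lemma vneighbourP r n (x y : 'cV[A]_n) :
  vneighbour r x y <-> forall al : 'I_r.+1 -> 'I_n, \prod_j (x (al j) 0 - y (al j) 0) = 0.
Proof.
split=> [H al|H phi ml].
  have := H (fun u => \prod_j (u j) (al j) 0); rewrite /multilinear => E.
  rewrite -[RHS]E.
    by apply: eq_bigr => j _; rewrite ffunE !mxE.
  move=> u i c v w; cbv zeta.
  have key z : \prod_j [ffun j => if j == i then z else u j] j (al j) 0 =
      z (al i) 0 * \prod_(j | j != i) u j (al j) 0.
    rewrite (bigD1 i) //= ffunE eqxx; congr (_ * _).
    by apply: eq_bigr => j /negPf nj; rewrite ffunE nj.
  by rewrite !key !mxE mulrDl mulrA.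
set z := x - y.
have P : forall j, (j <= r.+1)%N -> forall (al : 'I_r.+1 -> 'I_n) c,
    (forall be : 'I_r.+1 -> 'I_n, c * \prod_(k < r.+1 | (k < j)%N) z (be k) 0 = 0) ->
    c * phi [ffun k : 'I_r.+1 => if (k < j)%N then z else delta_mx (al k) 0] = 0.
  elim=> [_ al c Hc|j IH lj al c Hc].
    by have := Hc al; rewrite big_pred0 // mulr1 => ->; rewrite mul0r.
  pose i := Ordinal lj.
  rewrite (_ : [ffun k : 'I_r.+1 => _] = [ffun k => if k == i then z else
     [ffun k : 'I_r.+1 => if (k < j)%N then z else delta_mx (al k) 0] k]); last first.
    apply/ffunP => k; rewrite !ffunE ltnS leq_eqVlt -val_eqE /=.
    by case: eqP.
  rewrite multilinear_expand // big_distrr /= big1 // => a _; rewrite mulrA.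
  rewrite (_ : [ffun k => _] = [ffun k : 'I_r.+1 => if (k < j)%N then z else
      delta_mx (if k == i then a else al k) 0]); last first.
    apply/ffunP => k; rewrite !ffunE -val_eqE /=.
    by case: eqP => // ->; rewrite ltnn.
  apply: IH => [|be]; first exact: ltnW.
  have := Hc (fun k => if k == i then a else be k).
  rewrite (bigD1 i) //= eqxx mulrA => E; rewrite -[RHS]E; congr (_ * _).
  apply: eq_big => [k|k lk].
    by rewrite ltnS -val_eqE /= andbC -ltn_neqAle.
  suff -> : (k == i) = false by [].
  by rewrite -val_eqE /=; move: lk; rewrite ltn_neqAle => /andP[/negPf ->].
(* The induction starts from some choice al of basis vectors, so n = 0 has to be
   treated apart. *)
have [al|al0] : ('I_r.+1 -> 'I_n) + (n = 0%N).
- case: n x y H phi ml z P => [|n'] *; [by right|by left=> _; exact: ord0].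
- have := P r.+1 (leqnn _) al 1; rewrite mul1r => E; rewrite -[RHS]E.
    by congr phi; apply/ffunP => k; rewrite !ffunE ltn_ord.
  move=> be; rewrite mul1r -[RHS](H be); apply: eq_big => k; first by rewrite ltn_ord.
  by rewrite /z !mxE.
- have -> : [ffun=> z] = [ffun j => if j == ord0 then 0 *: z + 0 else [ffun => z] j] :> {ffun 'I_r.+1 -> 'cV[A]_n}.
    apply/ffunP => k; rewrite !ffunE; case: eqP => // _.
    by apply/matrixP => i; have := ltn_ord i; rewrite {2}al0.
  rewrite multilinear_expand // big1 // => a _.
  by have := ltn_ord a; rewrite {2}al0.
Qed.

Lemma vneighbour_sym r n (x y : 'cV[A]_n) : vneighbour r x y -> vneighbour r y x.
Proof.
move=> /vneighbourP H; apply/vneighbourP => al.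
under eq_bigr do rewrite -opprB -mulN1r.
by rewrite big_split /= H mulr0.
Qed.

Lemma vneighbour_row r k n (x : 'cV[A]_n) (Y : 'M[A]_(k, n)) i :
  row_nil r Y -> vneighbour r x (x + (row i Y)^T).
Proof.
move=> H; apply: vneighbour_sym; apply/vneighbourP => al.
by rewrite -[RHS](H i al); apply: eq_bigr => j _; rewrite !mxE [x _ _ + _]addrC addrK.
Qed.

End VNeighbour.

Lemma vneighbour_map (A B : comPzRingType) (f : {rmorphism A -> B}) r n (x y : 'cV[A]_n) :
  vneighbour r x y -> vneighbour r (map_mx f x) (map_mx f y).
Proof.
move=> /vneighbourP H; apply/vneighbourP => al.
rewrite -(rmorph0 f) -(H al) rmorph_prod; apply: eq_bigr => j _.
by rewrite !mxE rmorphB.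
Qed.

Section Charts.
Variables (C : site) (R : number_line C) (n : nat) (M : manifold R n).

Lemma vneighbour_local r (I : C) (x y : 'cV[R I]_n) :
  locally (fun J (f : hom J I) => vneighbour r (vec_res f x) (vec_res f y)) ->
  vneighbour r x y.
Proof.
move=> H; apply/vneighbourP => al; apply: line_separated.
apply: locally_sub H => J f /vneighbourP /(_ al) e.
rewrite rmorph0 -e rmorph_prod; apply: eq_bigr => j _.
by rewrite !mxE rmorphB.
Qed.

(** The point with coordinates v in the chart a; meaningful only if v is in the
    image of the chart, the point x serving as default. *)
Definition chart_point (I : C) (a : charts M I) (x : M I) (v : 'cV[R I]_n) : M I :=
  epsilon (inhabits x) (fun y => dom a y /\ coord a y = v).

Lemma chart_pointP r (I : C) (a : charts M I) (x : M I) (v : 'cV[R I]_n) :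
  dom a x -> vneighbour r (coord a x) v ->
  dom a (chart_point a x v) /\ coord a (chart_point a x v) = v.
Proof.
move=> ax xv; apply: (epsilon_spec (inhabits x) (fun z => dom a z /\ coord a z = v)).
by have [y ay e] := image_open ax xv; exists y.
Qed.

Lemma chart_point_coord (I : C) (a : charts M I) (x y : M I) :
  dom a y -> chart_point a x (coord a y) = y.
Proof.
move=> ay; have [ap e] : dom a (chart_point a x (coord a y)) /\ coord a (chart_point a x (coord a y)) = coord a y.
  by apply: (epsilon_spec (inhabits x) (fun z => dom a z /\ coord a z = coord a y)); exists y.
exact: (coord_inj ap ay).
Qed.

Lemma chart_point_res r (I J : C) (g : hom J I) (a : charts M I) (x : M I) (v : 'cV[R I]_n) :
  dom a x -> vneighbour r (coord a x) v ->
  res g (chart_point a x v) = chart_point (res g a) (res g x) (vec_res g v).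
Proof.
move=> ax xv; have [ap e] := chart_pointP ax xv.
have := chart_point_coord (res g x) (dom_res g ap).
by rewrite coord_res // e => ->.
Qed.

(** Changing charts preserves neighbours: by [hadamard] the coordinates in b of
    a neighbour of x differ from those of x by elements of the ideal of the
    coordinates in a, and r + 1 such elements have product zero. *)
Lemma vneighbour_chart r (I : C) (a b : charts M I) (x y : M I) :
  dom a x -> dom a y -> dom b x -> vneighbour r (coord a x) (coord a y) ->
  dom b y /\ vneighbour r (coord b x) (coord b y).
Proof.
move=> ax ay bx xy; split; first exact: (dom_open ax ay bx xy).
pose u c J (h : hom J I) (Y : 'M[R J]_(1, n)) : R J :=
  coord (res h b) (chart_point (res h a) (res h x) (coord (res h a) (res h x) + (row 0 Y)^T)) c 0.
have nu c : natural_mx r (u c).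
  move=> J K h g Y sY; rewrite /u.
  have hx : dom (res h a) (res h x) by apply: dom_res.
  have xv := vneighbour_row (coord (res h a) (res h x)) 0 sY.1.
  have [ap ep] := chart_pointP hx xv.
  have bp : dom (res h b) (chart_point (res h a) (res h x) (coord (res h a) (res h x) + (row 0 Y)^T)).
    by apply: (dom_open hx ap (dom_res h bx) (r := r)); rewrite ep.
  rewrite !res_comp.
  have -> : coord (res g (res h a)) (res g (res h x)) + (row 0 (map_mx (rres R g) Y))^T =
    vec_res g (coord (res h a) (res h x) + (row 0 Y)^T).
    by rewrite coord_res //; apply/matrixP => i j; rewrite !mxE rmorphD.
  by rewrite -(chart_point_res _ hx xv) coord_res // mxE.
pose Y : 'M[R I]_(1, n) := (coord a y - coord a x)^T.
have YE : coord a x + (row 0 Y)^T = coord a y.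
  by apply/matrixP => i j; rewrite !mxE ord1 addrC subrK.
have sY : simplex_mx r Y.
  split=> [i al|i i' al]; last first.
    by rewrite (ord1 i) (ord1 i') big_ord_recl subrr mul0r.
  have /vneighbourP H := vneighbour_sym xy.
  by rewrite (ord1 i) -[RHS](H al); apply: eq_bigr => j _; rewrite !mxE.
have oc c : order_ge (entries Y) 1 (coord b x c 0 - coord b y c 0).
  rewrite -opprB; apply: ord_opp.
  have := hadamard (nu c) (idm I) sY.
  rewrite /u !res_id YE chart_point_coord // (_ : coord a x + _ = coord a x) ?chart_point_coord //.
  by apply/matrixP => i j; rewrite !mxE addr0.
apply/vneighbourP => al; apply: (ord_nil sY.1).
have := ord_prod (E := entries Y) (index_enum 'I_r.+1) (d := fun _ => 1%N)
  (F := fun j => coord b x (al j) 0 - coord b y (al j) 0) (fun j => oc (al j)).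
by rewrite sum1_card card_ord mul1n.
Qed.

Lemma neighbour_res r (I J : C) (f : hom J I) (x y : M I) :
  neighbour r x y -> neighbour r (res f x) (res f y).
Proof.
move=> /(locally_pullback f); apply: locally_sub => K g [a H].
by exists a; rewrite -!res_comp.
Qed.

Lemma neighbour_chart r (I : C) (a : charts M I) (x y : M I) :
  dom a x -> neighbour r x y -> dom a y /\ vneighbour r (coord a x) (coord a y).
Proof.
move=> ax xy.
have H : locally (fun J (f : hom J I) => dom (res f a) (res f y) /\
   vneighbour r (coord (res f a) (res f x)) (coord (res f a) (res f y))).
  apply: locally_sub xy => J f [b [bx byy xy]].
  exact: (vneighbour_chart bx byy (dom_res f ax) xy).
have ay : dom a y by apply: dom_local; apply: locally_sub H => J f [].
split=> //; apply: vneighbour_local; apply: locally_sub H => J f [_].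
by rewrite !coord_res.
Qed.

Lemma neighbour_of r (I : C) (a : charts M I) (x y : M I) :
  dom a x -> dom a y -> vneighbour r (coord a x) (coord a y) -> neighbour r x y.
Proof.
move=> ax ay xy; apply: locally_everywhere => J f; exists (res f a).
by split; rewrite ?coord_res //; [apply: dom_res|apply: dom_res|apply: vneighbour_map].
Qed.

Definition displacement k (I : C) (a : charts M I) (X : power M k.+1 I) : 'M[R I]_(k, n) :=
  diff_mx (fun i => coord a (X i)).

(** The simplex at x whose displacement matrix in the chart a is Y. *)
Definition simplex_of_mx k (I : C) (a : charts M I) (x : M I) (Y : 'M[R I]_(k, n)) : power M k.+1 I :=
  [ffun i => if unlift ord0 i is Some j then chart_point a x (coord a x + (row j Y)^T) else x].

Lemma simplex_res r k (I J : C) (f : hom J I) (X : power M k.+1 I) :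
  simplex r X -> simplex r (res f X).
Proof. by move=> sX i j; rewrite !ffunE; apply: neighbour_res. Qed.

Lemma simplex_dom r k (I : C) (a : charts M I) (X : power M k.+1 I) :
  dom a (X ord0) -> simplex r X -> forall i, dom a (X i).
Proof. by move=> a0 sX i; have [] := neighbour_chart a0 (sX ord0 i). Qed.

Lemma simplex_displacement r k (I : C) (a : charts M I) (X : power M k.+1 I) :
  dom a (X ord0) -> simplex r X -> simplex_mx r (displacement a X).
Proof.
move=> a0 sX; have aX := simplex_dom a0 sX; split=> [i al|i i' al].
  have [_ /vneighbourP H] := neighbour_chart (aX _) (sX (lift ord0 i) ord0).
  by rewrite -[RHS](H al); apply: eq_bigr => j _; rewrite mxE.
have [_ /vneighbourP H] := neighbour_chart (aX _) (sX (lift ord0 i) (lift ord0 i')).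
rewrite -[RHS](H al); apply: eq_bigr => j _; rewrite !mxE.
by rewrite opprB addrA subrK.
Qed.

Lemma displacement_res k (I J : C) (g : hom J I) (a : charts M I) (X : power M k.+1 I) :
  (forall i, dom a (X i)) -> displacement (res g a) (res g X) = map_mx (rres R g) (displacement a X).
Proof.
by move=> aX; apply/matrixP => i c; rewrite !mxE !ffunE !coord_res // !mxE rmorphB.
Qed.

Lemma simplex_of_mx0 k (I : C) (a : charts M I) (x : M I) (Y : 'M[R I]_(k, n)) :
  simplex_of_mx a x Y ord0 = x.
Proof. by rewrite ffunE unlift_none. Qed.

Lemma simplex_of_mx_dom r k (I : C) (a : charts M I) (x : M I) (Y : 'M[R I]_(k, n)) i :
  dom a x -> simplex_mx r Y -> dom a (simplex_of_mx a x Y i).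
Proof.
move=> ax sY; rewrite ffunE; case: unliftP => // j _.
by have [] := chart_pointP ax (vneighbour_row (coord a x) j sY.1).
Qed.

Lemma simplex_of_mx_coord r k (I : C) (a : charts M I) (x : M I) (Y : 'M[R I]_(k, n)) i :
  dom a x -> simplex_mx r Y -> coord a (simplex_of_mx a x Y (lift ord0 i)) = coord a x + (row i Y)^T.
Proof.
move=> ax sY; rewrite ffunE liftK.
by have [] := chart_pointP ax (vneighbour_row (coord a x) i sY.1).
Qed.

Lemma displacement_of_mx r k (I : C) (a : charts M I) (x : M I) (Y : 'M[R I]_(k, n)) :
  dom a x -> simplex_mx r Y -> displacement a (simplex_of_mx a x Y) = Y.
Proof.
move=> ax sY; apply/matrixP => i c.
by rewrite mxE (simplex_of_mx_coord _ ax sY) simplex_of_mx0 !mxE [coord _ _ _ _ + _]addrC addrK.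
Qed.

Lemma simplex_of_mxP r k (I : C) (a : charts M I) (x : M I) (Y : 'M[R I]_(k, n)) :
  dom a x -> simplex_mx r Y -> simplex r (simplex_of_mx a x Y).
Proof.
move=> ax sY i j.
apply: (neighbour_of (a := a)); [exact: simplex_of_mx_dom sY|exact: simplex_of_mx_dom sY|].
case: (unliftP ord0 i) => [i' ->|->]; case: (unliftP ord0 j) => [j' ->|->];
  rewrite ?(simplex_of_mx_coord _ ax sY) ?simplex_of_mx0.
- apply/vneighbourP => al; rewrite -[RHS](sY.2 i' j' al); apply: eq_bigr => l _.
  by rewrite !mxE opprD addrACA subrr add0r.
- by apply: vneighbour_sym; apply: vneighbour_row sY.1.
- exact: vneighbour_row sY.1.
- by apply/vneighbourP => al; rewrite big_ord_recl subrr mul0r.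
Qed.

Lemma of_displacement r k (I : C) (a : charts M I) (X : power M k.+1 I) :
  dom a (X ord0) -> simplex r X -> simplex_of_mx a (X ord0) (displacement a X) = X.
Proof.
move=> a0 sX; apply/ffunP => i; rewrite ffunE; case: unliftP => [j ->|-> //].
rewrite (_ : _ + _ = coord a (X (lift ord0 j))).
  by rewrite chart_point_coord //; apply: simplex_dom sX _.
by apply/matrixP => c l; rewrite !mxE !ord1 addrC subrK.
Qed.

Lemma simplex_of_mx_res r k (I J : C) (g : hom J I) (a : charts M I) (x : M I) (Y : 'M[R I]_(k, n)) :
  dom a x -> simplex_mx r Y ->
  res g (simplex_of_mx a x Y) = simplex_of_mx (res g a) (res g x) (map_mx (rres R g) Y).
Proof.
move=> ax sY; apply/ffunP => i; rewrite !ffunE; case: unliftP => // j _.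
rewrite (chart_point_res _ ax (vneighbour_row (coord a x) j sY.1)); congr chart_point.
by rewrite coord_res //; apply/matrixP => c l; rewrite !mxE rmorphD.
Qed.

(** Functions on the r-infinitesimal simplices with first vertex x. *)
Definition natural_at r k (I : C) (x : M I)
    (t : forall J, hom J I -> power M k.+1 J -> R J) :=
  forall J K (h : hom J I) (g : hom K J) (X : power M k.+1 J), X ord0 = res h x -> simplex r X ->
    t K (comp h g) (res g X) = rres R g (t J h X).

Lemma natural_at_mx r k (I : C) (a : charts M I) (x : M I)
    (t : forall J, hom J I -> power M k.+1 J -> R J) :
  dom a x -> natural_at r x t ->
  natural_mx r (fun J h Y => t J h (simplex_of_mx (res h a) (res h x) Y)).
Proof.
move=> ax nt J K h g Y sY; rewrite !res_comp -(simplex_of_mx_res _ (dom_res h ax) sY).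
by apply: nt; [rewrite simplex_of_mx0|apply: simplex_of_mxP => //; apply: dom_res].
Qed.

End Charts.

(** * Densities, squares of forms, and Heron *)

Section Forms.
Variables (C : site) (R : number_line C) (n : nat) (M : manifold R n).

Lemma det_displacement_degenerate (I : C) (a : charts M I) (X : power M n.+1 I) i j :
  i != j -> X i = X j -> \det (displacement a X) = 0.
Proof.
move=> ne e; rewrite /displacement det_diff_mx; apply: (determinant_alternate ne) => l.
by rewrite !mxE e.
Qed.

Lemma simplex_of_mx_row0 k (I : C) (a : charts M I) (x : M I) (Y : 'M[R I]_(k, n)) i :
  dom a x -> (forall c, Y i c = 0) -> simplex_of_mx a x Y (lift ord0 i) = simplex_of_mx a x Y ord0.
Proof.
move=> ax Yi; rewrite simplex_of_mx0 ffunE liftK -[RHS](chart_point_coord x ax); congr chart_point.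
by apply/matrixP => c l; rewrite !mxE Yi addr0.
Qed.

Lemma simplex_of_mx_roweq k (I : C) (a : charts M I) (x : M I) (Y : 'M[R I]_(k, n)) i j :
  (forall c, Y i c = Y j c) -> simplex_of_mx a x Y (lift ord0 i) = simplex_of_mx a x Y (lift ord0 j).
Proof.
move=> Yij; rewrite !ffunE !liftK; congr (chart_point _ _ (_ + _)).
by apply/matrixP => c l; rewrite !mxE Yij.
Qed.

Lemma form_degenerate k (d : cochain M k) : is_form d ->
  forall (I : C) (X : power M k.+1 I), simplex 1 X ->
  forall i j, i != j -> X i = X j -> d I X = 0.
Proof.
move=> [_ alt] I X sX i j ne e; apply: (add_self_eq0 (R := R)).
have := alt I tt X (conj sX (fun _ => Logic.I)) (tperm i j).
rewrite odd_tperm ne expr1 mulN1r (_ : [ffun l => X (tperm i j l)] = X).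
  by move=> E; rewrite {1}E addNr.
by apply/ffunP => l; rewrite ffunE; case: tpermP => [->|->|].
Qed.

Lemma form_res k (d : cochain M k) : is_form d ->
  forall (I J : C) (g : hom J I) (X : power M k.+1 I), simplex 1 X ->
  d J (res g X) = rres R g (d I X).
Proof. by move=> [nat _] I J g X sX; apply: (nat I J g tt); split. Qed.

(** The density at x is the coefficient of [form_eq_diag] divided by n!, the
    determinant being n! times the product of the diagonal entries. *)
Lemma form_density (d : cochain M n) (I : C) (a : charts M I) (x : M I) :
  is_form d -> dom a x ->
  exists D : R I, forall J (h : hom J I) (X : power M n.+1 J),
    X ord0 = res h x -> simplex 1 X -> d J X = rres R h D * \det (displacement (res h a) X).
Proof.
move=> fd ax.
have sn : natural_at 1 x (fun J _ X => d J X).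
  by move=> J K h g X _ sX; apply: form_res.
have [|c Hc] := form_eq_diag (natural_at_mx ax sn).
  move=> J h Y sY i Yi; have hx := dom_res h ax.
  apply: (form_degenerate fd (simplex_of_mxP hx sY) (i := lift ord0 i) (j := ord0)) => //.
  exact: simplex_of_mx_row0.
exists (invn R I n`! * c) => J h X X0 sX.
have aX : dom (res h a) (X ord0) by rewrite X0; apply: dom_res.
have sY := simplex_displacement aX sX.
have := Hc J h _ sY; rewrite -X0 (of_displacement aX sX) => ->.
rewrite simplex1_det // mulrA; congr (_ * _).
by rewrite mulrC -[_%:R](rmorph_nat (rres R h)) -rmorphM mulrA invnE ?fact_gt0 ?mul1r.
Qed.

(** The scalar in front of det Y in an extension is read off from its values on
    1-infinitesimal simplices, hence equal to the density of the form. *)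
Lemma extension_sqr (I : C) (a : charts M I) (x : M I)
    (t : forall J, hom J I -> power M n.+1 J -> R J) (D : R I) :
  dom a x -> natural_at 2 x t ->
  (forall J (h : hom J I) (X : power M n.+1 J), X ord0 = res h x -> simplex 2 X ->
     forall i j, i != j -> X i = X j -> t J h X = 0) ->
  (forall J (h : hom J I) (X : power M n.+1 J), X ord0 = res h x -> simplex 1 X ->
     t J h X = rres R h D * \det (displacement (res h a) X)) ->
  forall J (h : hom J I) (X : power M n.+1 J), X ord0 = res h x -> simplex 2 X ->
    t J h X ^+ 2 = (rres R h D * \det (displacement (res h a) X)) ^+ 2.
Proof.
move=> ax nt t0 tD.
have [||c Hc] := extended_form_leading (natural_at_mx ax nt).
- move=> J h Y sY i Yi; have hx := dom_res h ax.
  apply: (t0 _ _ _ _ (simplex_of_mxP hx sY) (lift ord0 i) ord0) => //; first by rewrite simplex_of_mx0.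
  exact: simplex_of_mx_row0.
- move=> J h Y sY i j ne Yij; have hx := dom_res h ax.
  apply: (t0 _ _ _ _ (simplex_of_mxP hx sY) (lift ord0 i) (lift ord0 j)).
  + by rewrite simplex_of_mx0.
  + by rewrite (inj_eq lift_inj).
  + exact: simplex_of_mx_roweq.
have cD : c = D.
  apply: (extended_form_leading_unique Hc) => J h Y sY; have hx := dom_res h ax.
  rewrite tD ?simplex_of_mx0 //; last exact: simplex_of_mxP.
  by rewrite (displacement_of_mx hx sY).
move=> J h X X0 sX.
have aX : dom (res h a) (X ord0) by rewrite X0; apply: dom_res.
have sY := simplex_displacement aX sX.
have := extended_form_sqr Hc h sY.
by rewrite -X0 (of_displacement aX sX) cD.
Qed.

Lemma quadratic_sub (A : comPzRingType) (G : 'M[A]_n) (u v : 'cV[A]_n) : G^T = G ->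
  ((u - v)^T *m G *m (u - v)) 0 0 =
  (u^T *m G *m u) 0 0 + (v^T *m G *m v) 0 0 - 2%:R * (u^T *m G *m v) 0 0.
Proof.
move=> sG; have e : (v^T *m G *m u) 0 0 = (u^T *m G *m v) 0 0.
  by rewrite -{1}[v^T *m G *m u]trmxK mxE !trmx_mul trmxK sG mulmxA.
have -> : (u - v)^T = u^T - v^T by apply/matrixP => i j; rewrite !mxE.
rewrite !mulmxBl !mulmxBr.
move: e; move: (u^T *m G *m v) (v^T *m G *m u) (u^T *m G *m u) (v^T *m G *m v) => a b c d e.
by rewrite !mxE e; ring.
Qed.

Lemma bilinear_subm (A : comPzRingType) (G H : 'M[A]_n) (u v : 'cV[A]_n) :
  (u^T *m (G - H) *m v) 0 0 = (u^T *m G *m v) 0 0 - (u^T *m H *m v) 0 0.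
Proof. by rewrite mulmxBr mulmxBl [LHS]mxE [X in _ + X]mxE. Qed.

(** With y_i the displacement of x_i and G = G(x), the entries of the reduced
    Cayley-Menger matrix are -2 y_i^T G y_j up to terms of order 3, which come
    from comparing G(x_i) with G(x). *)
Lemma heron_det (g : metric M) (I : C) (a : charts M I)
    (G : forall J, hom J I -> M J -> 'M[R J]_n) :
  metric_matrix g a G -> forall X : power M n.+1 I, dom a (X ord0) -> simplex 2 X ->
  heron g X = invn R I n`! ^+ 2 * \det (G I (idm I) (X ord0)) * \det (displacement a X) ^+ 2.
Proof.
move=> [Gnat Gsym gG] X a0 sX.
set x := X ord0; set Y := displacement a X; set Gx := G I (idm I) x.
have aX := simplex_dom a0 sX; have sY : simplex_mx 2 Y := simplex_displacement a0 sX.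
have ra : res (idm I) a = a by rewrite res_id.
have sGx : Gx^T = Gx by apply: Gsym; rewrite ra.
pose y i : 'cV[R I]_n := (row i Y)^T.
have gE i j : g I (X i) (X j) = ((coord a (X i) - coord a (X j))^T *m G I (idm I) (X i)
    *m (coord a (X i) - coord a (X j))) 0 0.
  by rewrite (gG _ (idm I)) ?ra.
have yE i : coord a (X (lift ord0 i)) - coord a x = y i.
  by apply/matrixP => c l; rewrite !mxE ord1.
have spY : simplex_of_mx a x Y = X := of_displacement a0 sX.
(* From here on only spY, yE and sY are needed about Y. *)
clearbody Y.
have g0 j : g I x (X (lift ord0 j)) = ((y j)^T *m Gx *m y j) 0 0.
  rewrite gE -opprB yE (_ : (- y j)^T = - (y j)^T) ?mulNmx ?mulmxN ?opprK //.
  by apply/matrixP => b c; rewrite !mxE.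
have oG i b c : order_ge (entries Y) 1 (G I (idm I) (X (lift ord0 i)) b c - Gx b c).
  pose t J (h : hom J I) (Z : power M n.+1 J) := G J h (Z (lift ord0 i)) b c.
  have nt : natural_at 2 x t.
    move=> J K h k Z Z0 sZ; rewrite /t ffunE Gnat ?mxE //.
    by apply: simplex_dom sZ _; rewrite Z0; apply: dom_res.
  have := hadamard (natural_at_mx a0 nt) (idm I) sY.
  rewrite !ra !res_id spY [t _ _ (simplex_of_mx _ _ 0)](_ : _ = Gx b c) //.
  rewrite /t (_ : simplex_of_mx _ _ _ _ = x) // -[RHS](simplex_of_mx0 a x (0 : 'M_n)).
  by apply: simplex_of_mx_row0 => // l; rewrite mxE.
pose z i j := y i - y j.
have zE i j : coord a (X (lift ord0 i)) - coord a (X (lift ord0 j)) = z i j.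
  by rewrite /z -!yE opprB addrA subrK.
have oz i j c : order_ge (entries Y) 1 (z i j c 0).
  rewrite !mxE; apply: ord_add; first exact: ord_entry.
  by apply: ord_opp; apply: ord_entry.
pose Z : 'M[R I]_n :=
  \matrix_(i, j) ((z i j)^T *m (G I (idm I) (X (lift ord0 i)) - Gx) *m z i j) 0 0.
have oZ i j : order_ge (entries Y) 3 (Z i j).
  rewrite !mxE; apply: ord_sum => c _; rewrite -[3%N]/(2 + 1)%N; apply: ordM => //.
  rewrite mxE; apply: ord_sum => b _; rewrite mxE -[2%N]/(1 + 1)%N; apply: ordM => //.
  by rewrite !mxE.
pose B : 'M[R I]_n := (- 2%:R) *: (Y *m Gx *m Y^T).
have oB i j : order_ge (entries Y) 2 (B i j).
  rewrite !mxE; apply: ord_mul; apply: ord_sum => c _; rewrite -[2%N]/(1 + 1)%N.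
  apply: ordM; last by rewrite mxE; apply: ord_entry.
  by rewrite mxE; apply: ord_sum => b _; rewrite mulrC; apply: ord_mul; apply: ord_entry.
have NE : \matrix_(i < n, j < n) (g I (X (lift ord0 i)) (X (lift ord0 j))
    - g I (X (lift ord0 i)) x - g I x (X (lift ord0 j)) + g I x x) = B + Z.
  apply/matrixP => i j; rewrite [LHS]mxE gval_diag addr0.
  rewrite [g I (X (lift ord0 i)) x]gval_sym; last exact: sX.
  rewrite !g0 gE zE.
  have -> : ((z i j)^T *m G I (idm I) (X (lift ord0 i)) *m z i j) 0 0
      = ((z i j)^T *m Gx *m z i j) 0 0 + Z i j.
    by rewrite [Z i j]mxE bilinear_subm addrC subrK.
  rewrite quadratic_sub //.
  have -> : ((y i)^T *m Gx *m y j) 0 0 = (Y *m Gx *m Y^T) i j.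
    rewrite !mxE; apply: eq_bigr => c _; rewrite !mxE; congr (_ * _).
    by apply: eq_bigr => b _; rewrite !mxE.
  rewrite [RHS]mxE [B i j]mxE; move: (Z i j) (_ 0 0) (_ 0 0) (_ i j) => ? ? ? ?.
  by ring.
have detN : \det (B + Z) = (- 2%:R) ^+ n * (\det Gx * \det Y ^+ 2).
  have [e oe ->] := ord_det_add oB oZ.
  rewrite (ord_nil sY.1 oe) addr0 detZ !det_mulmx det_tr; congr (_ * _); ring.
have CM : \det (cayley_menger g X) = - \det (B + Z).
  rewrite -NE; apply: etrans (det_bordered _) _.
  by congr (- \det _); apply/matrixP => i j; rewrite !mxE.
rewrite /heron CM detN.
have i2 : (- invn R I 2) ^+ n * (- 2%:R) ^+ n = 1.
  by rewrite -exprMn mulrNN mulrC invnE // expr1n.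
transitivity (((- invn R I 2) ^+ n * (- 2%:R) ^+ n) * (invn R I n`! ^+ 2 * \det Gx * \det Y ^+ 2)).
  move: ((- invn _ _ _) ^+ n) ((- 2%:R) ^+ n) => ? ?; ring.
by rewrite i2 mul1r.
Qed.

Lemma heron_res (g : metric M) (I J : C) (f : hom J I) (X : power M n.+1 I) :
  simplex 2 X -> heron g (res f X) = rres R f (heron g X).
Proof.
have invn_res m : (0 < m)%N -> rres R f (invn R I m) = invn R J m.
  move=> m0; rewrite -[LHS]mul1r -(invnE R J m0) mulrAC.
  by rewrite -[_%:R](rmorph_nat (rres R f)) -rmorphM invnE // rmorph1 mul1r.
move=> sX; rewrite /heron rmorphN !rmorphM !rmorphXn rmorphN !invn_res ?fact_gt0 //.
congr (- (_ * _)); rewrite -det_map_mx; congr (\det _).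
rewrite /cayley_menger map_block_mx map_mx0 !map_const_mx !rmorph1; congr block_mx.
by apply/matrixP => i j; rewrite !mxE !ffunE gval_res.
Qed.

End Forms.

(** * Multiples of a form *)

Section Density.
Variables (C : site) (R : number_line C) (n : nat) (M : manifold R n).
Variable d : cochain M n.
Arguments d : clear implicits.
Hypothesis fd : is_form d.

Definition is_density (I : C) (a : charts M I) (x : M I) (D : R I) : Prop :=
  forall J (h : hom J I) (X : power M n.+1 J),
    X ord0 = res h x -> simplex 1 X -> d J X = rres R h D * \det (displacement (res h a) X).

Definition density (I : C) (a : charts M I) (x : M I) : R I :=
  epsilon (inhabits 0) (is_density a x).

Lemma densityP (I : C) (a : charts M I) (x : M I) :
  dom a x -> is_density a x (density a x).
Proof. by move=> ax; apply: epsilon_spec; apply: form_density. Qed.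

Lemma density_unique (I : C) (a : charts M I) (x : M I) D D' :
  dom a x -> is_density a x D -> is_density a x D' -> D = D'.
Proof.
move=> ax HD HD'; apply/eqP; rewrite -subr_eq0; apply/eqP.
apply: (@det_cancel _ R n) => J h Y sY.
have hx := dom_res h ax; have sX := simplex_of_mxP hx sY.
have := HD J h _ (simplex_of_mx0 _ _ _) sX; rewrite (HD' J h _ (simplex_of_mx0 _ _ _) sX).
by rewrite (displacement_of_mx hx sY) rmorphB mulrBl => ->; rewrite subrr.
Qed.

Lemma density_res (I J : C) (g : hom J I) (a : charts M I) (x : M I) :
  dom a x -> rres R g (density a x) = density (res g a) (res g x).
Proof.
move=> ax; apply: (density_unique (dom_res g ax)); last by apply: densityP; apply: dom_res.
move=> K h X X0 sX; rewrite -rres_comp -res_comp; apply: densityP => //.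
by rewrite res_comp.
Qed.

(** The evident extension of the form f * d to 2-infinitesimal simplices: the
    formula with the determinant makes sense for all simplices. *)
Definition multiple_ext (f : forall J : C, M J -> R J) (I : C) (a : charts M I)
    (J : C) (h : hom J I) (X : power M n.+1 J) : R J :=
  f J (X ord0) * (density (res h a) (X ord0) * \det (displacement (res h a) X)).

Lemma is_function_res (f : forall J : C, M J -> R J) : is_function f ->
  forall (I J : C) (g : hom J I) (x : M I), f J (res g x) = rres R g (f I x).
Proof. by move=> nf I J g x; apply: (nf I J g tt). Qed.

Lemma multiple_ext_extends (f : forall J : C, M J -> R J) (w : cochain M n)
    (I : C) (a : charts M I) :
  is_function f ->
  (forall J (X : power M n.+1 J), simplex 1 X -> w J X = f J (X ord0) * d J X) ->
  extends w a (multiple_ext f a).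
Proof.
move=> nf wE; split; first split.
- move=> J K g h X [sX aX]; rewrite /multiple_ext ffunE is_function_res //=.
  by rewrite res_comp -density_res // displacement_res // det_map_mx !rmorphM.
- by move=> J h X [sX aX] i j ne e; rewrite /multiple_ext (det_displacement_degenerate _ ne e) !mulr0.
- move=> J h X sX aX; rewrite wE // /multiple_ext; congr (_ * _).
  have := densityP (aX ord0) (h := idm J) (X := X); rewrite !res_id rres_id => <- //.
Qed.

(** The chart a in which the square is computed may differ from the chart b on
    which the extension lives; this is what makes the square, and with it the
    volume factor, independent of the chart. *)
Lemma extends_sqr (w : cochain M n) (I : C) (a b : charts M I) t
    (f : forall J : C, M J -> R J) (X : power M n.+1 I) :
  is_function f ->
  (forall J (X : power M n.+1 J), simplex 1 X -> w J X = f J (X ord0) * d J X) ->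
  extends w b t -> dom a (X ord0) -> dom b (X ord0) -> simplex 2 X ->
  t I (idm I) X ^+ 2 = (f I (X ord0) * (density a (X ord0) * \det (displacement a X))) ^+ 2.
Proof.
move=> nf wE [[nt t0] tw] a0 b0 sX; set x := X ord0.
have hdom J (h : hom J I) r (Z : power M n.+1 J) : Z ord0 = res h x -> simplex r Z ->
    forall i, dom (res h b) (Z i).
  by move=> Z0 sZ; apply: simplex_dom sZ; rewrite Z0; apply: dom_res.
have := extension_sqr (a := a) (x := x) (t := t) (D := f I x * density a x) a0.
move=> /(_ _ _ _ I (idm I) X); rewrite !res_id rres_id -mulrA; apply=> //.
- by move=> J K h g Z Z0 sZ; apply: nt; split=> //; apply: hdom sZ.
- by move=> J h Z Z0 sZ; apply: t0; split=> //; apply: hdom sZ.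
- move=> J h Z Z0 sZ; rewrite tw //; last by apply: hdom sZ.
  by rewrite wE // rmorphM -mulrA (densityP a0 Z0 sZ) Z0 is_function_res.
Qed.

(** The values of f at two vertices differ by an element of the ideal of the
    displacements, and d already has the top degree n. *)
Lemma form_vertex (f : forall J : C, M J -> R J) (I : C) (X : power M n.+1 I) i :
  is_function f -> simplex 1 X -> f I (X i) * d I X = f I (X ord0) * d I X.
Proof.
move=> nf sX; apply: line_separated.
apply: locally_sub (charts_cover (X ord0)) => J g [a a0].
rewrite !rmorphM -!is_function_res // -(form_res fd g sX).
have sgX : simplex 1 (res g X) by apply: simplex_res.
have -> j : res g (X j) = (res g X : power M n.+1 J) j by rewrite ffunE.
move: a0; have -> : res g (X ord0) = (res g X : power M n.+1 J) ord0 by rewrite ffunE.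
move: (res g X : power M n.+1 J) sgX => {g} {}X {}sX a0.
case: (unliftP ord0 i) => [j ->|-> //].
pose t K (h : hom K J) (Z : power M n.+1 K) := f K (Z (lift ord0 j)).
have nt : natural_at 1 (X ord0) t.
  by move=> K L h k Z _ _; rewrite /t ffunE is_function_res.
have sY := simplex_displacement a0 sX.
have := hadamard (natural_at_mx a0 nt) (idm J) sY.
rewrite /t !res_id (of_displacement a0 sX) simplex_of_mx_row0 ?simplex_of_mx0 //; last by move=> c; rewrite mxE.
move=> o1; apply/eqP; rewrite -subr_eq0 -mulrBl; apply/eqP.
have := densityP a0 (h := idm J) (X := X); rewrite !res_id => -> //.
have le1 : ((n * 1).+1 <= 1 + n)%N by rewrite muln1.
apply: (ord_nil sY.1); apply: (ord_leq le1); apply: ordM => //.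
by apply: ord_mul; apply: ord_det.
Qed.

End Density.

(** * The volume form *)

Section Volume.
Variables (C : site) (R : number_line C) (P : positivity R) (n : nat).
Variables (M : manifold R n) (d : cochain M n) (g : metric M).
Arguments d : clear implicits.
Hypotheses (d_orient : orientation_form d) (g_riem : riemannian g).

Let fd : is_form d := d_orient.1.

Definition chart_part (I : C) (a : charts M I) : open_part M (yoneda I).
Proof.
apply: (@OpenPart C R n M (yoneda I) (fun J h y => dom (res h a) y)).
- by move=> J K k h y; rewrite /= res_comp; apply: dom_res.
- move=> J h y H; apply: dom_local; apply: locally_sub H => K k /=.
  by rewrite res_comp.
- by move=> J h y z r ay yz; have [] := neighbour_chart ay yz.
Defined.

(** On the domain of a chart, det Y is itself a form, hence f * d for some f; so
    f times the density is 1 by cancellation of det Y. *)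
Lemma density_invertible (I : C) (a : charts M I) (x : M I) :
  dom a x -> invertible (density d a x).
Proof.
move=> ax.
have [|[f [nf fE]] _] := d_orient.2 I (chart_part a) (fun J h X => \det (displacement (res h a) X)).
  split=> [J K k h X [sX aX]|J h X [sX aX] s].
    by rewrite /= res_comp displacement_res // det_map_mx.
  rewrite -det_diff_mx_perm; congr (\det _); apply/matrixP => i c.
  by rewrite !mxE !ffunE.
exists (f I (idm I) x); apply/eqP; rewrite -subr_eq0; apply/eqP.
apply: (@det_cancel _ R n) => J h Y sY.
have hx := dom_res h ax; have sX := simplex_of_mxP hx sY.
have aX i : dom (res h a) (simplex_of_mx (res h a) (res h x) Y i) by apply: simplex_of_mx_dom sY.
have := fE J h _ sX aX; rewrite (displacement_of_mx hx sY) simplex_of_mx0.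
rewrite (densityP fd ax (simplex_of_mx0 _ _ _) sX) (displacement_of_mx hx sY).
have := nf I J h (idm I) x; rewrite /= comp1m res_id => -> // e.
by rewrite rmorphB rmorph1 rmorphM mulrBl mul1r {2}e mulrA [rres R h (f _ _ _) * _]mulrC subrr.
Qed.

Lemma pos_sqr (I : C) (x : R I) : invertible x -> pos P (x ^+ 2).
Proof.
move=> ix; apply: pos_local; apply: locally_sub (pos_or_neg P ix) => J f [p|p].
  by rewrite rmorphXn expr2; apply: posM.
by rewrite rmorphXn -sqrrN expr2; apply: posM.
Qed.

Lemma pos_sqr_inj (I : C) (x y : R I) : pos P x -> pos P y -> x ^+ 2 = y ^+ 2 -> x = y.
Proof.
move=> px py e; have [z [_ uz]] := pos_sqrt (posM py py).
by rewrite -(uz x) ?(uz y) // -?expr2.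
Qed.

Lemma invertible_mul (I : C) (x y : R I) : invertible x -> invertible y -> invertible (x * y).
Proof. by move=> [x' ex] [y' ey]; exists (x' * y'); rewrite mulrACA ex ey mulr1. Qed.

(** Locally det G = (det H)^2, and the square of an invertible element is
    positive because the element or its opposite is. *)
Lemma pos_det (I : C) (G : 'M[R I]_n) : positive_definite G -> pos P (\det G).
Proof.
move=> [iG H]; apply: pos_local; apply: locally_sub H => J f [H e].
rewrite -det_map_mx e det_mulmx det_tr -expr2; apply: pos_sqr.
case: iG => y /(congr1 (rres R f)); rewrite rmorphM rmorph1 -det_map_mx e det_mulmx det_tr => E.
by exists (\det H * rres R f y); rewrite mulrA.
Qed.

(** v is the value at x of the function f such that f * d squares to Heron: the
    equation f * d must satisfy is required in all charts around x, so that the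
    notion does not depend on a choice of chart. *)
Definition is_volume_factor (I : C) (x : M I) (v : R I) : Prop :=
  pos P v /\
  forall J (h : hom J I) (a : charts M J) (X : power M n.+1 J),
    dom a (X ord0) -> X ord0 = res h x -> simplex 2 X ->
    heron g X = (rres R h v * (density d a (X ord0) * \det (displacement a X))) ^+ 2.

Lemma is_volume_factor_res (I J : C) (f : hom J I) (x : M I) v :
  is_volume_factor x v -> is_volume_factor (res f x) (rres R f v).
Proof.
move=> [pv H]; split=> [|K k a X aX X0 sX]; first exact: pos_res.
by rewrite -rres_comp; apply: H => //; rewrite res_comp.
Qed.

(** The squares of v and v' agree after cancelling the square of the density
    times that of det Y; positive square roots are unique. *)
Lemma is_volume_factor_unique (I : C) (x : M I) v v' :
  is_volume_factor x v -> is_volume_factor x v' -> v = v'.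
Proof.
move=> Hv Hv'; apply: line_separated.
apply: locally_sub (charts_cover x) => J f [a ax].
have := is_volume_factor_res f Hv; have := is_volume_factor_res f Hv'.
move: (res f x) ax (rres R f v) (rres R f v') => {Hv Hv'} {}x ax {}v {}v' [pv' Hv'] [pv Hv].
apply: pos_sqr_inj => //; apply/eqP; rewrite -subr_eq0; apply/eqP.
have [D' eD] := density_invertible ax.
rewrite -[LHS]mulr1 -[1](expr1n _ 2) -eD exprMn mulrA.
rewrite [X in X * _](_ : _ = 0) ?mul0r //.
apply: (@det_sqr_cancel _ R n) => K h Y sY.
have hx := dom_res h ax; have sX := simplex_of_mxP hx sY.
have aX : dom (res h a) (simplex_of_mx (res h a) (res h x) Y ord0) by rewrite simplex_of_mx0.
have := Hv K h _ _ aX (simplex_of_mx0 _ _ _) sX; rewrite (Hv' K h _ _ aX (simplex_of_mx0 _ _ _) sX).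
rewrite (displacement_of_mx hx sY) simplex_of_mx0 -(density_res fd) // !exprMn => e.
by rewrite rmorphM rmorphB !rmorphXn -mulrA mulrBl e subrr.
Qed.

Lemma is_volume_factor_local (I : C) (x : M I) v :
  locally (fun J (f : hom J I) => is_volume_factor (res f x) (rres R f v)) ->
  is_volume_factor x v.
Proof.
move=> H; split=> [|J h a X aX X0 sX].
  by apply: pos_local; apply: locally_sub H => J f [].
apply: line_separated; apply: locally_sub (locally_pullback h H) => K k [_ Hk].
have sA := simplex_dom aX sX.
rewrite -heron_res // (Hk K (idm K) (res k a)) ?res_id.
- by rewrite rres_id ffunE -(density_res fd) // displacement_res // det_map_mx rres_comp -!rmorphM rmorphXn.
- by rewrite ffunE; apply: dom_res.
- by rewrite ffunE X0 res_comp.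
- exact: simplex_res.
Qed.

(** v is the positive square root of det G / (n! D)^2 computed in the chart a;
    by [extends_sqr] it then satisfies the equation in every other chart. *)
Lemma is_volume_factor_chart (I : C) (a : charts M I) (x : M I) :
  dom a x -> exists v, is_volume_factor x v.
Proof.
move=> ax; have [G mG pG] := g_riem a.
have pdG : pos P (\det (G I (idm I) x)).
  by apply: pos_det; apply: pG; rewrite res_id.
have [D' eD] := density_invertible ax.
pose N := invn R I n`!.
have eN : n`!%:R * N = 1 by rewrite invnE ?fact_gt0.
have iN : invertible (N * D').
  apply: invertible_mul; [by exists n`!%:R; rewrite mulrC|].
  by exists (density d a x); rewrite mulrC.
have [v [[pv ev] _]] := pos_sqrt (posM pdG (pos_sqr iN)).
exists v; split=> // J h b X bX X0 sX.
have hx := dom_res h ax.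
have aX : dom (res h a) (X ord0) by rewrite X0.
(* The form d is the multiple 1 * d; its extension in b is compared with the
   density of d in a. *)
have one_fun : is_function (fun J (_ : M J) => 1 : R J).
  by move=> K L k c y _; rewrite rmorph1.
have dE K (Z : power M n.+1 K) : simplex 1 Z -> d K Z = 1 * d K Z by rewrite mul1r.
have := extends_sqr fd one_fun dE (multiple_ext_extends fd b one_fun dE) aX bX sX.
rewrite /multiple_ext !mul1r !res_id => e.
rewrite [RHS]exprMn e {e}.
have mG' : metric_matrix g (res h a) (fun K (k : hom K J) y => G K (comp h k) y).
  case: mG => G1 G2 G3; split=> [K L k l y|K k y|K k y z]; rewrite -res_comp.
  - by rewrite compA; apply: G1.
  - exact: G2.
  - exact: G3.
rewrite (heron_det mG' aX sX) compm1.
have -> : G J h (X ord0) = map_mx (rres R h) (G I (idm I) x).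
  by case: mG => G1 _ _; rewrite X0 -G1 ?comp1m // res_id.
rewrite det_map_mx X0 -(density_res fd) // exprMn mulrA; congr (_ * _).
rewrite -!rmorphXn -rmorphM ev exprMn.
have -> : \det (G I (idm I) x) * (N ^+ 2 * D' ^+ 2) * density d a x ^+ 2
  = N ^+ 2 * \det (G I (idm I) x) * (density d a x * D') ^+ 2 by ring.
rewrite eD expr1n mulr1 rmorphM rmorphXn; congr (_ ^+ 2 * _).
rewrite -[LHS]mul1r -(rmorph1 (rres R h)) -eN rmorphM rmorph_nat mulrAC.
by rewrite invnE ?fact_gt0 ?mul1r.
Qed.

Lemma is_volume_factor_exists (I : C) (x : M I) : exists v, is_volume_factor x v.
Proof.
have [|||v Hv|v] := @line_glue C R I (fun J h v => is_volume_factor (res h x) v).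
- by move=> J K h k v; rewrite res_comp; apply: is_volume_factor_res.
- by move=> J h v v'; apply: is_volume_factor_unique.
- by apply: locally_sub (charts_cover x) => J f [a]; apply: is_volume_factor_chart.
- by rewrite res_id; apply: is_volume_factor_local.
- by rewrite res_id; exists v.
Qed.

Definition volume_factor (I : C) (x : M I) : R I := epsilon (inhabits 0) (is_volume_factor x).

Lemma volume_factorP (I : C) (x : M I) : is_volume_factor x (volume_factor x).
Proof. by apply: epsilon_spec; apply: is_volume_factor_exists. Qed.

Lemma volume_factor_function : is_function volume_factor.
Proof.
move=> I J f b x _; apply: (@is_volume_factor_unique _ (res f x)); first exact: volume_factorP.
by apply: is_volume_factor_res; apply: volume_factorP.
Qed.

Lemma square_value_multiple (f : forall J : C, M J -> R J) (w : cochain M n)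
    (I : C) (X : power M n.+1 I) :
  is_function f ->
  (forall J (X : power M n.+1 J), simplex 1 X -> w J X = f J (X ord0) * d J X) ->
  simplex 2 X -> is_volume_factor (X ord0) (f I (X ord0)) -> square_value w X (heron g X).
Proof.
move=> nf wE sX [_ H]; split.
  apply: locally_sub (charts_cover (X ord0)) => J h [a a0]; exists a.
    move=> i; have := simplex_dom (X := res h X) (a := a) _ (simplex_res h sX) i.
    by rewrite !ffunE; apply.
  by exists (multiple_ext d f a); apply: multiple_ext_extends.
move=> J h a aX t tE; have aX' i : dom a ((res h X : power M n.+1 J) i) by rewrite ffunE.
have sX' := simplex_res h sX.
rewrite (extends_sqr fd nf wE tE (aX' ord0) (aX' ord0) sX') -heron_res //.
have a0 := aX ord0; rewrite (H J h a (res h X)) ?ffunE //.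
by rewrite is_function_res.
Qed.

Lemma is_volume_factor_multiple (f : forall J : C, M J -> R J) (w : cochain M n) :
  is_function f -> (forall J (x : M J), pos P (f J x)) ->
  (forall J (X : power M n.+1 J), simplex 1 X -> w J X = f J (X ord0) * d J X) ->
  (forall J (X : power M n.+1 J), simplex 2 X -> square_value w X (heron g X)) ->
  forall (I : C) (x : M I), is_volume_factor x (f I x).
Proof.
move=> nf pf wE sw I x; split=> // J h a X aX X0 sX.
have [_ H] := sw J X sX.
have aX' i : dom a (res (idm J) (X i)) by rewrite res_id; apply: simplex_dom sX i.
have := H J (idm J) a aX' _ (multiple_ext_extends fd a nf wE).
rewrite !res_id rres_id => <-.
by rewrite /multiple_ext res_id X0 is_function_res.
Qed.

End Volume.

Theorem theorem4p1 (C : site) (R : number_line C) (P : positivity R) (n : nat)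
    (M : manifold R n) (d : cochain M n) (d_orient : orientation_form d)
    (g : metric M) (g_riem : riemannian g) :
  let volume (w : cochain M n) :=
    [/\ is_form w, positive_form P d w &
        forall (I : C) (X : power M n.+1 I), simplex 2 X ->
          square_value w X (heron g X)] in
  (exists w : cochain M n, volume w) /\
  (forall w w' : cochain M n, volume w -> volume w' ->
     forall (I : C) (X : power M n.+1 I), simplex 1 X -> w I X = w' I X).
Proof.
move=> volume; split.
  have nf := volume_factor_function P d_orient g_riem.
  pose w : cochain M n := fun J X => volume_factor P d g (X ord0) * d J X.
  have fd := d_orient.1.
  exists w; split.
  - split=> [J K k b X [sX _]|J b X [sX _] s].
      by rewrite /w ffunE (is_function_res nf) (form_res fd) // rmorphM.
    rewrite /w ffunE; have [_ alt] := fd.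
    rewrite (alt J b X) // mulrCA (form_vertex fd _ nf) //.
  - exists (fun J x => volume_factor P d g x); split=> // J x.
    by have [] := volume_factorP P d_orient g_riem x.
  - move=> I X sX; apply: (square_value_multiple d_orient nf) => //.
    exact: volume_factorP.
move=> w w' [_ [f [nf pf wE]] sw] [_ [f' [nf' pf' wE']] sw'] I X sX.
rewrite wE // wE' //; congr (_ * _).
apply: (is_volume_factor_unique (P := P) (g := g) d_orient (x := X ord0)).
  exact: is_volume_factor_multiple wE sw _ _.
exact: is_volume_factor_multiple wE' sw' _ _.
Qed.
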